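(* Let $K$ be an algebraically closed field of characteristic $0$ and let $W \subseteq \mathbb{G}_{m,K}^n$ be a geometrically non-degenerate subvariety of dimension $d \in \{1,\dots,n-1\}$. For $N \in \mathbb{N}$, let $\mathcal{S}(W,N) \subseteq \mathbb{Z}^{nd}$ be the set of vectors $(a_{i,j})_{i=1,\dots,d;\ j=1,\dots,n}$ with $\max_{i,j}|a_{i,j}| \leq N$ such that for every $y = (y_1,\dots,y_d) \in (K^\times)^d$ there exists $x = (x_1,\dots,x_n) \in W(K)$ with $\prod_{j=1}^n x_j^{a_{i,j}} = y_i$ for $i = 1,\dots,d$. Then \[ \lim_{N\to\infty} \frac{\#\mathcal{S}(W,N)}{(2N+1)^{nd}} = 1. \]
   Context: $\mathbb{G}_{m,K}^n$ is the $n$-th power of the multiplicative group over $K$, with $K$-points $(K^\times)^n$. An irreducible subvariety $W \subseteq \mathbb{G}_{m,K}^n$ is geometrically non-degenerate if for every algebraic subgroup $J \leq \mathbb{G}_{m,K}^n$, with quotient map $\pi_J$, one has $\dim \pi_J(W) = \min\{\dim W, n - \dim J\}$ (in particular $W$ is irreducible). *)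

(* Defs.v *)
From mathcomp Require Import all_boot all_order all_algebra.
From mathcomp Require Import finmap mpoly.
From mathcomp Require Import boolp classical_sets functions cardinality.

Set Implicit Arguments.
Unset Strict Implicit.
Unset Printing Implicit Defensive.

Import GRing.Theory.
Local Open Scope classical_set_scope.
Local Open Scope ring_scope.

(* Varieties over the algebraically closed field K are identified with their
   sets of K-points; a subset of G_m^n is a set of points 'I_n -> K all of
   whose coordinates are nonzero. *)
Section Torus.
Variable K : closedFieldType.

Definition torus (n : nat) : set ('I_n -> K) := [set x | forall i, x i != 0].

(* Polynomials suffice in place of Laurent polynomials: the two differ by a
   monomial, which has no zero on the torus. *)
Definition zariski_closed (n : nat) (Z : set ('I_n -> K)) : Prop :=
  exists S : set {mpoly K[n]},
    Z = [set x | torus x /\ forall p, S p -> p.@[x] = 0].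

(* Irreducibility of Z for the topology induced by the Zariski topology. *)
Definition zariski_irreducible (n : nat) (Z : set ('I_n -> K)) : Prop :=
  [/\ Z `<=` @torus n,
      Z !=set0
    & forall A B, zariski_closed A -> zariski_closed B ->
        Z `<=` A `|` B -> Z `<=` A \/ Z `<=` B].

(* C 0 < C 1 < ... < C k, with each C i irreducible and closed in Z. *)
Definition irreducible_chain (n : nat) (Z : set ('I_n -> K)) (k : nat)
    (C : nat -> set ('I_n -> K)) : Prop :=
  (forall i, (i <= k)%N ->
     zariski_irreducible (C i) /\
     exists2 F, zariski_closed F & C i = Z `&` F) /\
  (forall i, (i < k)%N -> C i `<` C i.+1).

(* Dimension of the topological space Z (Z need not be closed in G_m^n, so
   this applies to the image of a variety as well). *)
Definition has_dim (n : nat) (Z : set ('I_n -> K)) (d : nat) : Prop :=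
  (exists C, irreducible_chain Z d C) /\
  (forall k C, irreducible_chain Z k C -> (k <= d)%N).

Definition algebraic_subgroup (n : nat) (J : set ('I_n -> K)) : Prop :=
  [/\ zariski_closed J,
      J (fun=> 1),
      forall x y, J x -> J y -> J (fun i => x i * y i)
    & forall x, J x -> J (fun i => (x i)^-1)].

(* Elements of K[x_1^{+-1}, ..., x_n^{+-1}] as functions on G_m^n. *)
Definition regular_on_torus (n : nat) (f : ('I_n -> K) -> K) : Prop :=
  exists (p : {mpoly K[n]}) (k : nat),
    forall x, torus x -> f x = p.@[x] / (\prod_(i < n) x i) ^+ k.

(* Homomorphisms of algebraic groups G_m^n -> G_m^r; the values of f outside
   the torus are irrelevant. *)
Definition torus_hom (n r : nat) (f : ('I_n -> K) -> ('I_r -> K)) : Prop :=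
  [/\ forall x, torus x -> torus (f x),
      forall i, regular_on_torus (fun x => f x i)
    & forall x y, torus x -> torus y ->
        f (fun i => x i * y i) = (fun i => f x i * f y i)].

(* The quotient G_m^n / J is again a torus G_m^r, and in characteristic 0 the
   quotient maps are exactly the surjective homomorphisms with kernel J. *)
Definition quotient_map (n r : nat) (J : set ('I_n -> K))
    (f : ('I_n -> K) -> ('I_r -> K)) : Prop :=
  [/\ torus_hom f,
      forall y, torus y -> exists2 x, torus x & f x = y
    & J = [set x | torus x /\ f x = (fun=> 1)]].

Definition geom_nondegenerate (n : nat) (W : set ('I_n -> K)) : Prop :=
  [/\ zariski_closed W,
      zariski_irreducible W
    & forall (J : set ('I_n -> K)) (r : nat) (f : ('I_n -> K) -> ('I_r -> K)),
        algebraic_subgroup J -> quotient_map J f ->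
        forall dW dJ, has_dim W dW -> has_dim J dJ ->
          has_dim (f @` W) (minn dW (n - dJ))].

Definition solvable_exponents (n d : nat) (W : set ('I_n -> K)) (N : nat) :
    set 'M[int]_(d, n) :=
  [set a : 'M[int]_(d, n) | (forall i j, (`|a i j| <= N)%N) /\
     forall y : 'I_d -> K, torus y ->
       exists2 x, W x & forall i, \prod_(j < n) x j ^ a i j = y i].

(* Hence #|` fset_set _| is the actual cardinality of this set (fset_set
   sends infinite sets to the empty finite set). *)
Lemma finite_solvable_exponents (n d : nat) (W : set ('I_n -> K)) (N : nat) :
  finite_set (@solvable_exponents n d W N).
Proof.
pose g (b : 'M['I_N.*2.+1]_(d, n)) : 'M[int]_(d, n) :=
  map_mx (fun k : 'I_N.*2.+1 => k%:Z - N%:Z) b.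
apply: (@sub_finite_set _ _ (range g)); last exact: finite_image.
move=> a [ha _]; exists (map_mx (fun z : int => inord (absz (z + N%:Z))) a) => //.
apply/matrixP => i j; rewrite !mxE.
have := ha i j; case: (a i j) => m /= hm.
  rewrite inordK; first by rewrite PoszD addrK.
  by rewrite ltnS -addnn leq_add2r.
have -> : Negz m + N%:Z = (N - m.+1)%N%:Z.
  by rewrite NegzE addrC subzn.
rewrite inordK /=; first by rewrite -subzn // addrAC subrr add0r.
by rewrite ltnS -addnn (leq_trans (leq_subr _ _)) ?leq_addr.
Qed.

End Torus.

Arguments solvable_exponents [K n] d W N.

(* Main.v *)
(* Let r >= d be the largest number of coordinates that are algebraically
   independent on W. Any r + 1 coordinates satisfy a polynomial relation on W;
   let E be the finite set of differences of exponents of these relations. In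
   a valued field containing a generic point of W, two terms of maximal
   absolute value in each relation give an element of E whose monomial is a
   unit, and the elements so obtained span a subspace of dimension >= n - r.
   Hence if the rows of an r x n matrix a are in general position with respect
   to E, the coordinates are units at every place where the monomials x^{a_i}
   are units. The x^{a_i} are algebraically independent on W, so for y in the
   torus the specialization x^{a_i} |-> y_i extends to a place of the function
   field, and all the coordinates specialize to nonzero values: this is the
   required point of W. Only O(1/N) of the r x n matrices in the box are not in
   general position, and a d x n matrix that is not solvable has no solvable
   extension to r rows. *)

Require Import Defs.
From HB Require Import structures.
From mathcomp Require Import all_boot all_order all_algebra finmap mpoly.
From mathcomp Require Import boolp classical_sets functions cardinality.
From mathcomp Require Import reals topology normedtype sequences.
From mathcomp Require Import zify.
Set Implicit Arguments.
Unset Strict Implicit.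
Unset Printing Implicit Defensive.
Import Order.TTheory GRing.Theory Num.Theory numFieldNormedType.Exports.
Local Open Scope classical_set_scope.
Local Open Scope ring_scope.

(** * Extension of places *)

Section Places.
Variables (K : closedFieldType) (F : fieldType) (iota : {rmorphism K -> F}).

(* G is the graph of a K-algebra homomorphism from a subalgebra of F to K. *)
Record partial_hom (G : set (F * K)) : Prop := PartialHom {
  ph_const : forall c, G (iota c, c);
  ph_add : forall a b c d, G (a, c) -> G (b, d) -> G (a + b, c + d);
  ph_mul : forall a b c d, G (a, c) -> G (b, d) -> G (a * b, c * d);
  ph_fun : forall c, G (0, c) -> c = 0 }.

(** The domain of [G] is a valuation ring of [F] containing the constants, with residue field [K]:
    elements of nonzero value are invertible in it, and an element outside it has an inverse of
    value 0. *)
Record place (G : set (F * K)) : Prop := Place {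
  place_ph :> partial_hom G;
  place_inv : forall b c, c != 0 -> G (b, c) -> G (b^-1, c^-1);
  place_val : forall x, (exists c, G (x, c)) \/ G (x^-1, 0) }.

Lemma ph0 G : partial_hom G -> G (0, 0).
Proof. by move=> hG; have := ph_const hG 0; rewrite rmorph0. Qed.

Lemma ph1 G : partial_hom G -> G (1, 1).
Proof. by move=> hG; have := ph_const hG 1; rewrite rmorph1. Qed.

Lemma ph_sub G a b c d : partial_hom G ->
  G (a, c) -> G (b, d) -> G (a - b, c - d).
Proof.
move=> hG Ga Gb; apply: ph_add => //.
have := ph_mul hG (ph_const hG (-1)) Gb.
by rewrite rmorphN rmorph1 !mulN1r.
Qed.

Lemma ph_sum G (I : Type) (r : seq I) (P : pred I) (a : I -> F) (c : I -> K) :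
  partial_hom G -> (forall i, P i -> G (a i, c i)) ->
  G (\sum_(i <- r | P i) a i, \sum_(i <- r | P i) c i).
Proof.
move=> hG Gac; elim: r => [|i r IH]; first by rewrite !big_nil; exact: ph0.
by rewrite !big_cons; case: ifP => // Pi; apply: ph_add (Gac _ Pi) IH.
Qed.

Lemma ph_maximal G0 : partial_hom G0 -> exists G, [/\ G0 `<=` G,
  partial_hom G & forall G', partial_hom G' -> G `<=` G' -> G' `<=` G].
Proof.
move=> hG0.
(* Zorn is applied to the sets [X] for which [G0] together with [X] is a partial homomorphism, so
   that the empty chain causes no trouble. *)
have [|A [hA maxA]] := @Zorn_bigcup _ (fun X => partial_hom (G0 `|` X)).
  move=> C CP Ctot; set U := \bigcup_(X in C) X.
  have sub X : C X -> G0 `|` X `<=` G0 `|` U.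
    by move=> CX; apply: setUS => x Xx; exists X.
  have get x y : (G0 `|` U) x -> (G0 `|` U) y ->
      exists2 H, [/\ partial_hom H, H x & H y] & H `<=` G0 `|` U.
    move=> [Gx|[X CX Xx]] [Gy|[Y CY Yy]].
    - by exists G0 => // z; left.
    - exists (G0 `|` Y); last exact: sub.
      by split; [exact: CP|left|right].
    - exists (G0 `|` X); last exact: sub.
      by split; [exact: CP|right|left].
    - have [XY|YX] := Ctot _ _ CX CY.
      + exists (G0 `|` Y); last exact: sub.
        by split; [exact: CP|right; exact: XY|right].
      + exists (G0 `|` X); last exact: sub.
        by split; [exact: CP|right|right; exact: YX].
  split.
  - by move=> c; left; exact: ph_const.
  - by move=> a b c d /get h /h [H [hH Ha Hb]]; apply; exact: ph_add.
  - by move=> a b c d /get h /h [H [hH Ha Hb]]; apply; exact: ph_mul.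
  - move=> c h; have [H [hH Ha _] _] := get _ _ h h; exact: ph_fun Ha.
exists (G0 `|` A); split=> // G' hG' sG'.
have G'E : G0 `|` (G' `|` A) = G'.
  apply/seteqP; split=> x; last by right; left.
  by case=> [G0x|[//|Ax]]; apply: sG'; [left|right].
move=> x G'x; right; apply: contrapT => nAx.
apply: (maxA (G' `|` A)); last by rewrite G'E.
split; first by move=> y Ay; right.
by move=> /(_ x) h; apply: nAx; apply: h; left.
Qed.

(** The extension of [G] to polynomials in [x] with [x] sent to [s]; [q] is a coefficientwise image
    of [p]. It is in general only a relation, and [adjoin_ph] tells when it is a graph. *)
Definition adjoin (G : set (F * K)) (x : F) (s : K) : set (F * K) :=
  [set z | exists (p : {poly F}) (q : {poly K}), (forall i, G (p`_i, q`_i)) /\ z = (p.[x], q.[s])].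

Lemma ph_coefM G (p p' : {poly F}) (q q' : {poly K}) : partial_hom G ->
  (forall i, G (p`_i, q`_i)) -> (forall i, G (p'`_i, q'`_i)) ->
  forall i, G ((p * p')`_i, (q * q')`_i).
Proof. by move=> hG h h' i; rewrite !coefM; apply: ph_sum => // j _; exact: ph_mul. Qed.

Lemma ph_coefC G a c : partial_hom G -> G (a, c) ->
  forall i, G (a%:P`_i, c%:P`_i).
Proof. by move=> hG h i; rewrite !coefC; case: eqP => // _; exact: ph0. Qed.

Lemma adjoin_sub G x s : partial_hom G -> G `<=` adjoin G x s.
Proof.
move=> hG [a c] Gac; exists a%:P, c%:P.
by split; [exact: ph_coefC|rewrite !hornerC].
Qed.

Lemma adjoin_gen G x s : partial_hom G -> adjoin G x s (x, s).
Proof.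
move=> hG; exists 'X, 'X; split; last by rewrite !hornerX.
by move=> i; rewrite !coefX; case: eqP => _; [exact: ph1|exact: ph0].
Qed.

Lemma adjoin_ph G x s : partial_hom G ->
  (forall (p : {poly F}) (q : {poly K}), (forall i, G (p`_i, q`_i)) -> p.[x] = 0 -> q.[s] = 0) ->
  partial_hom (adjoin G x s).
Proof.
move=> hG h; split.
- by move=> c; apply: adjoin_sub => //; exact: ph_const.
- move=> _ _ _ _ [p [q [Gpq [-> ->]]]] [p' [q' [Gpq' [-> ->]]]].
  exists (p + p'), (q + q'); split; last by rewrite !hornerD.
  by move=> i; rewrite !coefD; exact: ph_add.
- move=> _ _ _ _ [p [q [Gpq [-> ->]]]] [p' [q' [Gpq' [-> ->]]]].
  exists (p * p'), (q * q'); split; last by rewrite !hornerM.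
  exact: ph_coefM.
- by move=> c [p [q [Gpq [/esym p0 ->]]]]; exact: h Gpq p0.
Qed.

(* The images in K[T] of the relations satisfied by x form an ideal. *)
Lemma relation_ideal G (x : F) : partial_hom G ->
  let A (q : {poly K}) := exists p : {poly F}, (forall i, G (p`_i, q`_i)) /\ p.[x] = 0 in
  (exists s, forall q, A q -> q.[s] = 0) \/ A 1.
Proof.
move=> hG A.
have AM r q : A q -> A (r * q).
  move=> [p [Gp p0]]; exists (map_poly iota r * p).
  split; last by rewrite hornerM p0 mulr0.
  by apply: ph_coefM => // i; rewrite coef_map; exact: ph_const.
have AB q q' : A q -> A q' -> A (q - q').
  move=> [p [Gp p0]] [p' [Gp' p'0]]; exists (p - p').
  split; last by rewrite hornerD hornerN p0 p'0 subr0.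
  by move=> i; rewrite !coefB; exact: ph_sub.
have [[q [Aq q0]]|nA] := pselect (exists q, A q /\ q != 0); last first.
  left; exists 0 => q Aq; have [->|q0] := eqVneq q 0; first by rewrite horner0.
  by case: nA; exists q.
(* A nonzero element of least degree generates the ideal. It is either a constant, which gives 1, or
   has a root in [K], where the whole ideal vanishes. *)
have ex : exists m, `[< exists q : {poly K}, [/\ A q, q != 0 & size q = m] >].
  by exists (size q); apply/asboolP; exists q.
case: (ex_minnP ex) => m /asboolP [q1 [Aq1 q10 sq1]] minm.
have [s1|/closed_rootP [s rs]] := eqVneq (size q1) 1%N.
  right; move/eqP: s1 => /size_poly1P [c c0 qc].
  have := AM (c^-1)%:P _ Aq1.
  by rewrite qc -polyCM mulVf.
left; exists s => q2 Aq2; apply/eqP; rewrite -/(root q2 s).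
suff /divpK <- : q1 %| q2 by rewrite rootM rs orbT.
rewrite /dvdp; apply/negPn/negP => h.
have := ltn_modp q2 q1; rewrite q10 sq1 ltnNge; case/negP.
apply: minm; apply/asboolP; exists (q2 %% q1); split=> //.
have -> : q2 %% q1 = q2 - q2 %/ q1 * q1 by rewrite {2}(divp_eq q2 q1) addrC addKr.
by apply: AB => //; exact: AM.
Qed.

(* [infinite_rel G k x] witnesses, with degree at most k, that the hom G cannot
   be extended to x, i.e. that x would have to be sent to infinity. *)
Definition infinite_rel (G : set (F * K)) (k : nat) (x : F) :=
  exists p : {poly F}, [/\ (size p <= k.+1)%N, p.[x] = 0
    & forall i, G (p`_i, (i == 0%N)%:R)].

(** Reversing the relation of [x^-1] gives a relation of degree [l] for [x] whose leading
    coefficient has value 1, hence is invertible. A multiple of it cancels the top term of the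
    relation of [x]; the multiplier has value 0, so the image stays equal to 1. *)
Lemma infinite_rel_lower G k l x : partial_hom G ->
  (forall (b : F) (c : K), c != 0 -> G (b, c) -> G (b^-1, c^-1)) -> x != 0 ->
  infinite_rel G k x -> infinite_rel G l x^-1 -> (l <= k)%N ->
  exists2 k', (k' < k)%N & infinite_rel G k' x.
Proof.
move=> hG invG x0 [p [sp px hp]] [p' [sp' px' hp']] lk.
have u0 : p'`_0 != 0.
  apply/eqP => h; have := hp' 0%N; rewrite h => /(ph_fun hG)/eqP.
  by rewrite oner_eq0.
have l0 : (0 < l)%N.
  case: l sp' {lk} => // sp'; exfalso; move: px'.
  by rewrite (size1_polyC sp') hornerC => /eqP; rewrite (negbTE u0).
case: k sp lk => [|k] sp lk; first by move: (leq_trans l0 lk).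
pose rv := \poly_(i < l.+1) p'`_(l - i).
have rvx : rv.[x] = 0.
  transitivity (x ^+ l * p'.[x^-1]); last by rewrite px' mulr0.
  rewrite horner_poly (horner_coef_wide _ sp') big_distrr /=.
  rewrite (reindex_inj rev_ord_inj) /=; apply: eq_bigr => i _.
  have il : (i <= l)%N by rewrite -ltnS.
  rewrite subSS subKn // mulrCA; congr (_ * _).
  rewrite exprVn; apply: (canRL (mulfK _)); first exact: expf_neq0.
  by rewrite -exprD subnK.
pose c := p`_k.+1 / p'`_0.
have Gu : G ((p'`_0)^-1, 1) by have := invG _ _ (oner_neq0 _) (hp' 0%N); rewrite invr1.
have Gc : G (c, 0) by have := ph_mul hG (hp k.+1) Gu; rewrite mul0r.
exists k => //; exists (p - c *: ('X^(k.+1 - l) * rv)); split.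
- apply/leq_sizeP => j; rewrite leq_eqVlt => /orP[/eqP<-|kj].
    rewrite coefB coefZ coefXnM ltnNge leq_subr /= subKn // coef_poly ltnSn subnn.
    by rewrite /c divfK // subrr.
  rewrite coefB coefZ coefXnM coef_poly (nth_default _ (leq_trans sp kj)) sub0r.
  rewrite ltnNge (leq_trans (leq_subr _ _) (ltnW kj)) /=.
  by rewrite ifF ?mulr0 ?oppr0 // ltnNge; apply/negbF; rewrite ltn_subRL subnK.
- by rewrite hornerD hornerN hornerZ hornerM rvx !mulr0 subr0.
- move=> i; rewrite coefB coefZ -[X in G (_, X)]subr0; apply: ph_sub => //.
  have [z Gz] : exists z, G (('X^(k.+1 - l) * rv)`_i, z).
    rewrite coefXnM coef_poly; case: ifP => _; first by exists 0; exact: ph0.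
    by case: ifP => _; [eexists; exact: hp'|exists 0; exact: ph0].
  by have := ph_mul hG Gc Gz; rewrite mul0r.
Qed.

(** Infinite descent on [k + l]: the relation of larger degree, for [x] or for its inverse, can
    always be shortened. *)
Lemma infinite_rel_excl G k l x : partial_hom G ->
  (forall (b : F) (c : K), c != 0 -> G (b, c) -> G (b^-1, c^-1)) -> x != 0 ->
  infinite_rel G k x -> infinite_rel G l x^-1 -> False.
Proof.
move=> hG invG; have [N] := ubnP (k + l)%N.
elim: N k l x => // N IH k l x; rewrite ltnS => klN x0 hk hl.
have [lk|/ltnW kl] := leqP l k.
  have [k' k'k hk'] := infinite_rel_lower hG invG x0 hk hl lk.
  by apply: (IH k' l x) => //; apply: leq_trans klN; rewrite ltn_add2r.
have xV0 : x^-1 != 0 by rewrite invr_eq0.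
have [|l' l'l hl'] := infinite_rel_lower hG invG xV0 hl _ kl; first by rewrite invrK.
by apply: (IH k l' x) => //; apply: leq_trans klN; rewrite ltn_add2l.
Qed.

(** Chevalley's extension theorem: a maximal partial homomorphism is a place, since it can be
    extended neither by inverting an element of nonzero value nor by adjoining a finite element. *)
Lemma place_exists G0 : partial_hom G0 -> exists2 G, G0 `<=` G & place G.
Proof.
move=> /ph_maximal [G [G0G hG maxG]]; exists G => //.
have invG b c : c != 0 -> G (b, c) -> G (b^-1, c^-1).
  move=> c0 Gbc; have b0 : b != 0.
    by apply: contraNneq c0 => b0; rewrite b0 in Gbc; rewrite (ph_fun hG Gbc).
  (* [H] is the extension of [G] to the localization at [b]; by maximality it is contained in
     [G]. *)
  pose H := [set z : F * K | exists k, G (z.1 * b ^+ k, z.2 * c ^+ k)].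
  have GX k : G (b ^+ k, c ^+ k).
    elim: k => [|k IH]; first by rewrite !expr0; exact: ph1.
    by rewrite !exprS; exact: ph_mul.
  have GH : G `<=` H by move=> [x y] Gxy; exists 0%N; rewrite !expr0 !mulr1.
  apply: (maxG H) => //; last by exists 1%N; rewrite /= !expr1 !mulVf //; exact: ph1.
  split.
  - by move=> x; apply: GH; exact: ph_const.
  - move=> x x' y y' [k /= Gk] [k' /= Gk']; exists (k + k')%N => /=.
    rewrite !exprD !mulrDl; apply: ph_add => //.
      by rewrite !mulrA; exact: ph_mul.
    by rewrite !(mulrCA _ (_ ^+ k)); exact: ph_mul.
  - move=> x x' y y' [k /= Gk] [k' /= Gk']; exists (k + k')%N => /=.
    by rewrite !exprD !(mulrACA _ _ (_ ^+ k)); exact: ph_mul.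
  - move=> x [k /=]; rewrite mul0r => /(ph_fun hG)/eqP.
    by rewrite mulf_eq0 expf_eq0 (negbTE c0) andbF orbF => /eqP.
have finite x : (exists c, G (x, c)) \/ exists k, infinite_rel G k x.
  have [[s hs]|[p [Gp px]]] := relation_ideal x hG.
    left; exists s; apply: (maxG (adjoin G x s)).
    - by apply: adjoin_ph => // p q Gpq px; apply: hs; exists p.
    - exact: adjoin_sub.
    - exact: adjoin_gen.
  right; exists (size p), p; split=> // i.
  by have := Gp i; rewrite coef1.
split=> // x; have [->|x0] := eqVneq x 0.
  by left; exists 0; exact: ph0.
have [fx|[k hk]] := finite x; first by left.
have [[c Gc]|[l hl]] := finite x^-1; last by case: (infinite_rel_excl hG invG x0 hk hl).
have [c0|c0] := eqVneq c 0; first by right; rewrite -c0.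
by left; exists c^-1; rewrite -[x]invrK; exact: invG.
Qed.

Section PlaceTheory.
Variables (G : set (F * K)) (hG : place G).

Definition place_unit (x : F) := exists2 c, c != 0 & G (x, c).

Lemma place_unit1 : place_unit 1.
Proof. by exists 1; [exact: oner_neq0|exact: (ph1 hG)]. Qed.

Lemma place_unitM x y : place_unit x -> place_unit y -> place_unit (x * y).
Proof.
move=> [c c0 Gc] [d d0 Gd]; exists (c * d); last exact: (ph_mul hG).
by rewrite mulf_neq0.
Qed.

Lemma place_unitV x : place_unit x -> place_unit x^-1.
Proof. by move=> [c c0 Gc]; exists c^-1; [rewrite invr_eq0|exact: (place_inv hG)]. Qed.

(** The value group is torsion free: if [x] or its inverse had value 0, so would its positive
    powers. *)
Lemma place_unit_pow x k : (0 < k)%N -> place_unit (x ^+ k) -> place_unit x.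
Proof.
move=> k0 [c c0 Gc].
have [x0|x0] := eqVneq x 0.
  by move: Gc c0; rewrite x0 expr0n gtn_eqF //= => /(ph_fun hG) ->; rewrite eqxx.
have zX z : G (z, 0) -> G (z ^+ k, 0).
  move=> Gz; case: k k0 {Gc} => // k _; elim: k => [//|k IH].
  by rewrite exprS -(mulr0 0); exact: (ph_mul hG).
have nz : ~ G (1, 0) by move=> /(ph_sub hG (ph1 hG)); rewrite subrr subr0 => /(ph_fun hG)/eqP; rewrite oner_eq0.
have [[d Gd]|/zX h] := place_val hG x; last first.
  case: nz; have := ph_mul hG Gc h.
  by rewrite exprVn mulfV ?expf_neq0 // mulr0.
have [d0|] := eqVneq d 0; last by exists d.
rewrite d0 in Gd; have := ph_sub hG Gc (zX _ Gd); rewrite subrr subr0.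
by move=> /(ph_fun hG) c0'; rewrite c0' eqxx in c0.
Qed.

(* M i and M j have maximal absolute value for the valuation of the place. *)
Lemma place_two_terms (I : eqType) (s : seq I) (c : I -> K) (M : I -> F) :
  s != [::] -> uniq s -> (forall i, i \in s -> c i != 0) ->
  (forall i, i \in s -> M i != 0) -> \sum_(i <- s) iota (c i) * M i = 0 ->
  exists i j, [/\ i \in s, j \in s, i != j & place_unit (M i / M j)].
Proof.
move=> s0 us c0 M0 sum0.
(* The term [M m] has maximal absolute value, found by comparing the terms one at a time. *)
have [m ms hm] : exists2 m, m \in s & forall i, i \in s -> exists e, G (M i / M m, e).
  elim: s s0 {us c0 sum0} M0 => // i s IH _ M0.
  have [->|s0] := eqVneq s [::].
    exists i; rewrite ?mem_head // => j; rewrite inE => /eqP->.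
    by exists 1; rewrite mulfV ?M0 ?mem_head //; exact: (ph1 hG).
  have [|m ms hm] := IH s0; first by move=> j js; apply: M0; rewrite inE js orbT.
  have Mm : M m != 0 by rewrite M0 // inE ms orbT.
  have Mi : M i != 0 by rewrite M0 // mem_head.
  have [[e Ge]|h] := place_val hG (M i / M m).
    exists m => [|j]; first by rewrite inE ms orbT.
    by rewrite inE => /orP[/eqP->|]; [exists e|exact: hm].
  exists i => [|j]; first exact: mem_head.
  rewrite inE => /orP[/eqP->|/hm [e Ge]].
    by exists 1; rewrite mulfV //; exact: (ph1 hG).
  exists (e * 0); have := ph_mul hG Ge h.
  by rewrite invf_div mulrA divfK.
have [e he] : exists e : I -> K, forall i, i \in s -> G (M i / M m, e i).
  have /choice : forall i, exists e, i \in s -> G (M i / M m, e).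
    move=> i; have [/hm [e Ge]|_] := boolP (i \in s); first by exists e.
    by exists 0.
  by move=> [e he]; exists e.
(* If every other quotient by [M m] had value 0, the relation divided by [M m] would specialize to
   [c m = 0]. *)
apply: contrapT => nex.
have e0 i : i \in s -> i != m -> e i = 0.
  move=> si im; apply/eqP; apply/negPn/negP => ei0; apply: nex.
  by exists i, m; split=> //; exists (e i) => //; exact: he.
have Mm := M0 _ ms.
have em : e m = 1.
  have := ph_sub hG (he _ ms) (ph1 hG); rewrite mulfV // subrr => /(ph_fun hG)/eqP.
  by rewrite subr_eq0 => /eqP.
have := ph_sum s (P := mem s) (a := fun i => iota (c i) * (M i / M m)) (c := fun i => c i * e i) hG.
have -> : \sum_(i <- s | i \in s) iota (c i) * (M i / M m) = 0.
  rewrite -big_seq; under eq_bigr do rewrite mulrA.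
  by rewrite -mulr_suml sum0 mul0r.
rewrite -big_seq (bigD1_seq m) //= em mulr1 big_seq_cond big1 ?addr0; last first.
  by move=> i /andP[si im]; rewrite e0 // mulr0.
move=> h; have /(ph_fun hG) cm : G (0, c m).
  by apply: h => i si; apply: (ph_mul hG); [exact: (ph_const hG)|exact: he].
by have := c0 _ ms; rewrite cm eqxx.
Qed.

End PlaceTheory.
End Places.

(** * Subfields, and fraction fields of quotients by prime ideals *)

Section Subfield.
Variables (F : fieldType) (S : {pred F}).
Hypotheses (S1 : 1 \in S) (SB : {in S &, forall x y, x - y \in S})
  (SV : {in S &, forall x y, x / y \in S}).

Let S_divring : divring_closed S.
Proof. by split. Qed.

HB.instance Definition _ := GRing.isDivringClosed.Build F S S_divring.

Record subfield := Subfield { subfield_val :> F; _ : subfield_val \in S }.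
HB.instance Definition _ := [isSub for subfield_val].
HB.instance Definition _ := [Choice of subfield by <:].
HB.instance Definition _ := [SubChoice_isSubIntegralDomain of subfield by <:].
HB.instance Definition _ := [SubIntegralDomain_isSubField of subfield by <:].

Lemma subfield_exists : exists (E : fieldType) (f : {rmorphism E -> F}),
  forall z, z \in S <-> exists e, f e = z.
Proof.
exists subfield, (val : {rmorphism subfield -> F}) => z; split=> [Sz|[e <-]].
  by exists (Subfield Sz).
exact: valP.
Qed.
End Subfield.

Section PrimeQuotient.
Variables (R : comNzRingType) (I : {pred R}).
Hypotheses (I0 : 0 \in I) (I1 : 1 \notin I)
  (IMD : forall a, {in I &, forall u v, a * u + v \in I})
  (I_prime : prime_idealr_closed I).

Let I_ideal : idealr_closed I. Proof. by split. Qed.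

HB.instance Definition _ := isIdealr.Build R I I_ideal.
HB.instance Definition _ := isPrimeIdealrClosed.Build R I I_prime.

Let Q := {ideal_quot I}.
HB.instance Definition _ := GRing.ComNzRing.on Q.

(** The fraction field is formed from a domain equipped with a partial inverse; choice supplies one
    on the quotient. *)
Let inv_exists (x : Q) : exists y : Q, (exists z, z * x = 1) -> y * x = 1.
Proof.
have [[z zx]|nz] := pselect (exists z, z * x = 1); first by exists z.
by exists 0.
Qed.

Let inv_fun := projT1 (choice inv_exists).
Let unit := [pred x : Q | `[< exists z, z * x = 1 >]].
Let inv x := if x \in unit then inv_fun x else x.

Let mulVq : {in unit, left_inverse 1 inv *%R}.
Proof.
move=> x ux; rewrite /inv ux; have /asboolP h := ux.
exact: (projT2 (choice inv_exists) x h).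
Qed.

Let unitP x y : y * x = 1 -> x \in unit.
Proof. by move=> yx; apply/asboolP; exists y. Qed.

Let inv0id : {in [predC unit], inv =1 id}.
Proof. by move=> x; rewrite inE /inv /= => /negbTE ->. Qed.

HB.instance Definition _ :=
  GRing.ComNzRing_hasMulInverse.Build Q mulVq unitP inv0id.
HB.instance Definition _ := GRing.ComUnitRing_isIntegral.Build Q
  (@Quotient.rquot_IdomainAxiom R I).

Lemma prime_quotient_field : exists (F : fieldType) (f : {rmorphism R -> F}),
  forall x, f x = 0 <-> x \in I.
Proof.
exists {fraction Q}, (@tofrac Q \o (\pi_Q)%qT) => x /=.
have E : (x \in I) = (\pi_Q x == 0)%qT.
  by rewrite -[x in LHS]subr0 Quotient.idealrBE -(rmorph0 (\pi_Q)%qT).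
by rewrite E; split=> [/eqP|/eqP ->]; [rewrite tofrac_eq0|rewrite tofrac0].
Qed.
End PrimeQuotient.

(** * Algebraic independence and chains of irreducible sets *)

Section Independence.
Variables (K : closedFieldType) (n : nat).
Implicit Types (p q f : {mpoly K[n]}) (I : {set 'I_n}) (Z : set ('I_n -> K)).

Definition vars_in I p :=
  forall m, m \in msupp p -> forall j, j \notin I -> m j = 0%N.

Definition vanishes p Z := forall x, Z x -> p.@[x] = 0.

(** The coordinates with index in [I] are algebraically independent as functions on [Z]. *)
Definition indep Z I := forall p, vars_in I p -> vanishes p Z -> p = 0.

Lemma vars_in0 I : vars_in I 0.
Proof. by move=> m; rewrite msupp0 in_nil. Qed.

Lemma vars_inX I (m : 'X_{1..n}) : (forall j, j \notin I -> m j = 0%N) -> vars_in I 'X_[m].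
Proof. by move=> hm m'; rewrite msuppX inE => /eqP->. Qed.

Lemma vars_in1 I : vars_in I 1.
Proof. by rewrite -mpolyX0; apply: vars_inX => j _; rewrite mnmE. Qed.

Lemma vars_inD I p q : vars_in I p -> vars_in I q -> vars_in I (p + q).
Proof.
move=> hp hq m /msuppD_le; rewrite mem_cat => /orP[]; [exact: hp|exact: hq].
Qed.

Lemma vars_inN I p : vars_in I p -> vars_in I (- p).
Proof. by move=> hp m; rewrite (perm_mem (msuppN p)); exact: hp. Qed.

Lemma vars_inM I p q : vars_in I p -> vars_in I q -> vars_in I (p * q).
Proof.
move=> hp hq m /msuppM_le /allpairsP [[m1 m2] /= [h1 h2 ->]] j jI.
by rewrite mnmDE (hp _ h1) // (hq _ h2).
Qed.

Lemma vars_inZ I c p : vars_in I p -> vars_in I (c *: p).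
Proof. by move=> hp m /msuppZ_le; exact: hp. Qed.

Lemma vars_in_sum I (T : Type) (r : seq T) (P : pred T) (F : T -> {mpoly K[n]}) :
  (forall i, P i -> vars_in I (F i)) -> vars_in I (\sum_(i <- r | P i) F i).
Proof. by move=> h; apply: big_ind => //; [exact: vars_in0|exact: vars_inD]. Qed.

Lemma vars_in_prod I (T : Type) (r : seq T) (P : pred T) (F : T -> {mpoly K[n]}) :
  (forall i, P i -> vars_in I (F i)) -> vars_in I (\prod_(i <- r | P i) F i).
Proof. by move=> h; apply: big_ind => //; [exact: vars_in1|exact: vars_inM]. Qed.

Lemma indepS Z Z' I : Z `<=` Z' -> indep Z I -> indep Z' I.
Proof. by move=> ZZ' hI p pI pZ'; apply: hI => // x /ZZ'; exact: pZ'. Qed.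

Lemma vars_in_univariate I j p : vars_in (j |: I) p ->
  exists N (c : nat -> {mpoly K[n]}), (forall k, vars_in I (c k)) /\
    p = \sum_(k < N) c k * 'X_j ^+ k.
Proof.
(* [z] erases the exponent of [X_j], and [c k] collects the monomials of degree [k] in [X_j]. *)
move=> pI; pose z (m : 'X_{1..n}) := [multinom if i == j then 0%N else m i | i < n].
pose N := \max_(m <- msupp p) m j.
exists N.+1, (fun k => \sum_(m <- msupp p | (m \in msupp p) && (inord (m j) == inord k :> 'I_N.+1)) p@_m *: 'X_[z m]).
split=> [k|].
  apply: vars_in_sum => m /andP[mp _]; apply/vars_inZ/vars_inX => i iI.
  rewrite mnmE; case: eqP => // /eqP ij; apply: (pI m mp).
  by rewrite !inE negb_or ij.
rewrite {1}[p]mpolyE big_seq.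
rewrite (partition_big (fun m : 'X_{1..n} => inord (m j) : 'I_N.+1) predT) //=.
apply: eq_bigr => k _; rewrite inord_val mulr_suml; apply: eq_bigr => m /andP[mp /eqP mk].
rewrite -scalerAl; congr (_ *: _).
have -> : k = m j :> nat by rewrite -mk inordK // ltnS; exact: leq_bigmax_seq.
rewrite mpolyXn -mpolyXD; congr 'X_[_]; apply/mnmP => i.
rewrite mnmDE mulmnE mnm1E mnmE eq_sym.
by case: eqP => [->|_]; rewrite ?mul1n ?add0n ?mul0n ?addn0.
Qed.

Lemma zariski_closed_locus p : zariski_closed [set x : 'I_n -> K | torus x /\ p.@[x] = 0].
Proof.
exists [set p]; apply/seteqP; split=> x [tx h]; split=> //; first by move=> _ ->.
exact: h.
Qed.

(** The ideal of [Z] is prime: if [u * v] vanishes on [Z], the loci of [u] and [v] cover [Z], and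
    irreducibility puts [Z] inside one of them. *)
Lemma function_field Z : zariski_irreducible Z ->
  exists (F : fieldType) (phi : {rmorphism {mpoly K[n]} -> F}),
    forall p, phi p = 0 <-> vanishes p Z.
Proof.
move=> [Zt [z Zz] Zirr].
pose I := [pred p | `[< vanishes p Z >]].
have I0 : 0 \in I by apply/asboolP => x _; rewrite meval0.
have I1 : 1 \notin I.
  by apply/negP => /asboolP /(_ z Zz)/eqP; rewrite meval1 oner_eq0.
have IMD (a : {mpoly K[n]}) : {in I &, forall u v, a * u + v \in I}.
  move=> u v /asboolP hu /asboolP hv; apply/asboolP => x Zx.
  by rewrite mevalD mevalM hu // hv // mulr0 addr0.
have Ip : prime_idealr_closed I.
  move=> u v /asboolP huv; apply/orP.
  have [x Zx|h|h] := Zirr _ _ (zariski_closed_locus u) (zariski_closed_locus v).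
  - have := huv _ Zx; rewrite mevalM => /eqP; rewrite mulf_eq0.
    by case/orP=> /eqP h; [left|right]; split=> //; exact: Zt.
  - by left; apply/asboolP => x /h [].
  - by right; apply/asboolP => x /h [].
have [F [phi hphi]] := prime_quotient_field I0 I1 IMD Ip.
by exists F, phi => p; rewrite hphi; split=> /asboolP.
Qed.

(** Otherwise the function field of [Z2] is algebraic over the field generated by the coordinates in
    [I]. Then [f], nonzero on [Z2], satisfies an equation with nonzero constant term and
    coefficients polynomial in these coordinates. On [Z1], where [f] vanishes, the constant term
    must vanish, against independence. *)
Lemma indep_proper_closed Z1 Z2 f I :
  zariski_irreducible Z2 -> Z1 `<=` Z2 -> vanishes f Z1 -> ~ vanishes f Z2 ->
  indep Z1 I -> exists2 j, j \notin I & indep Z2 (j |: I).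
Proof.
move=> irr2 Z12 f1 f2 ind1; apply: contrapT => nex.
have [F [phi hphi]] := function_field irr2.
have ind2 : indep Z2 I := indepS Z12 ind1.
have phi_neq0 p : vars_in I p -> p != 0 -> phi p != 0.
  by move=> pI; apply: contra_neq => /hphi; exact: ind2.
(* The subfield of fractions of polynomials in the coordinates of [I]. *)
pose S := [pred z : F | `[< exists p q, [/\ vars_in I p, vars_in I q, q != 0
  & z = phi p / phi q] >]].
have inS p : vars_in I p -> phi p \in S.
  move=> pI; apply/asboolP; exists p, 1; split=> //; first exact: vars_in1.
    exact: oner_neq0.
  by rewrite rmorph1 divr1.
have S1 : 1 \in S by rewrite -(rmorph1 phi); apply/inS/vars_in1.
have SB : {in S &, forall x y, x - y \in S}.
  move=> _ _ /asboolP [p [q [pI qI q0 ->]]] /asboolP [p' [q' [pI' qI' q0' ->]]].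
  apply/asboolP; exists (p * q' - p' * q), (q * q'); split.
  - by apply: vars_inD; [|apply: vars_inN]; exact: vars_inM.
  - exact: vars_inM.
  - exact: mulf_neq0.
  - by rewrite -mulNr addf_div ?phi_neq0 // rmorphB !rmorphM mulNr.
have SV : {in S &, forall x y, x / y \in S}.
  move=> _ _ /asboolP [p [q [pI qI q0 ->]]] /asboolP [p' [q' [pI' qI' q0' ->]]].
  have [->|p0'] := eqVneq p' 0.
    by rewrite rmorph0 mul0r invr0 mulr0 -(rmorph0 phi); apply/inS/vars_in0.
  apply/asboolP; exists (p * q'), (q * p'); split; try exact: vars_inM.
    exact: mulf_neq0.
  by rewrite !rmorphM invf_div mulf_div.
have [E [g gP]] := subfield_exists S1 SB SV.
have algX j : algebraicOver g (phi 'X_j).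
  have [jI|jI] := boolP (j \in I).
    have /gP [e <-] : phi 'X_j \in S.
      apply/inS/vars_inX => i iI; rewrite mnm1E; case: eqP => // ji.
      by rewrite -ji jI in iI.
    exact: algebraic_id.
  have [p [pI p2 p0]] : exists p, [/\ vars_in (j |: I) p, vanishes p Z2 & p != 0].
    apply: contrapT => h; apply: nex; exists j => // p pI p2.
    by apply/eqP/negPn/negP => p0; apply: h; exists p.
  have [N [c [cI pE]]] := vars_in_univariate pI.
  have /choice [e he] : forall k, exists e, g e = phi (c k) by move=> k; apply/gP/inS.
  exists (\poly_(k < N) e k).
    apply: contraNneq p0 => q0; rewrite pE big1 // => k _.
    have := congr1 (fun q : {poly E} => q`_k) q0; rewrite /= coef_poly ltn_ord coef0 => ek0.
    have [->|ck0] := eqVneq (c k) 0; first by rewrite mul0r.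
    by have := phi_neq0 _ (cI k) ck0; rewrite -he ek0 rmorph0 eqxx.
  rewrite /root (@horner_coef_wide _ N) ?size_map_poly ?size_poly //.
  rewrite -[X in X == 0](_ : phi p = _); first by apply/eqP/hphi.
  rewrite pE rmorph_sum; apply: eq_bigr => i _.
  by rewrite coef_map /= coef_poly ltn_ord he rmorphM rmorphXn.
have alg p : algebraicOver g (phi p).
  rewrite [p]mpolyE rmorph_sum; apply: big_ind; [exact: algebraic0|exact: algebraic_add|].
  move=> m _; rewrite -mul_mpolyC rmorphM; apply: algebraic_mul.
    have /gP [e <-] : phi (p@_m)%:MP \in S; last exact: algebraic_id.
    apply: inS => m'; rewrite msuppC; case: ifP => // _.
    by rewrite inE => /eqP-> j _; rewrite mnmE.
  rewrite mpolyXE_id rmorph_prod; apply: big_ind; [exact: algebraic1|exact: algebraic_mul|].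
  move=> j _; rewrite rmorphXn; elim: (m j) => [|k IH]; first exact: algebraic1.
  by rewrite exprS; exact: algebraic_mul.
have pf0 : phi f != 0 by apply/eqP => /hphi.
(* Powers of the variable are divided out of an equation of [f], which is harmless since [phi f] is
   nonzero. *)
have [q qf q0] : exists2 q : {poly E}, root (map_poly g q) (phi f) & q`_0 != 0.
  have [q q0 qf] := alg f.
  have [m [r /implyP /(_ q0) r0 qE]] := multiplicity_XsubC q 0.
  exists r; last by rewrite -horner_coef0.
  move: qf; rewrite qE rmorphM rootM rmorphXn /= rmorphB /= map_polyX map_polyC /= rmorph0.
  case/orP=> // ; rewrite /root horner_exp !hornerE expf_eq0 subr0 (negbTE pf0).
  by rewrite andbF.
have /choice [pq hpq] : forall i, exists pq : {mpoly K[n]} * {mpoly K[n]},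
    [/\ vars_in I pq.1, vars_in I pq.2, pq.2 != 0 & g q`_i = phi pq.1 / phi pq.2].
  move=> i; have /asboolP [p' [q' h]] : g q`_i \in S by apply/gP; exists q`_i.
  by exists (p', q').
(* The successor ensures that the index [ord0] of the constant term exists. Below, [a i] is the
   coefficient [q_i] multiplied by the common denominator [D]. *)
pose N := (size q).+1.
pose D := \prod_(j < N) (pq j).2.
pose a (i : 'I_N) := (pq i).1 * \prod_(j < N | j != i) (pq j).2.
have aI i : vars_in I (a i).
  apply: vars_inM; first by case: (hpq i).
  by apply: vars_in_prod => j _; case: (hpq j).
have D0 : phi D != 0.
  rewrite phi_neq0 //; last by apply/prodf_neq0 => j _; case: (hpq j).
  by apply: vars_in_prod => j _; case: (hpq j).
have aE i : phi (a i) = phi D * g q`_i.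
  have [_ h2 h20 ->] := hpq i; rewrite /D (bigD1 i) //= !rmorphM.
  by rewrite [RHS]mulrC mulrA divfK ?phi_neq0.
have h2 : vanishes (\sum_(i < N) a i * f ^+ i) Z2.
  apply/hphi; rewrite rmorph_sum.
  transitivity (phi D * (map_poly g q).[phi f]); last by rewrite (eqP qf) mulr0.
  rewrite (@horner_coef_wide _ N) ?size_map_poly ?leqnSn // mulr_sumr.
  by apply: eq_bigr => i _; rewrite rmorphM rmorphXn aE coef_map mulrA.
have a0 : a ord0 = 0.
  apply: ind1 => // x Zx; have := h2 x (Z12 _ Zx).
  rewrite big_ord_recl expr0 mulr1 mevalD raddf_sum big1 ?addr0 // => i _.
  by rewrite /= mevalM rmorphXn /= f1 // exprS mul0r mulr0.
have := aE ord0; rewrite a0 rmorph0 => /esym/eqP.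
by rewrite mulf_eq0 (negbTE D0) fmorph_eq0 (negbTE q0).
Qed.

(** Each strict inclusion of the chain allows one more independent coordinate. The start is the
    empty set, since a constant vanishing on a nonempty set is zero. *)
Lemma irreducible_chain_indep Z k C : irreducible_chain Z k C ->
  exists2 I : {set 'I_n}, #|I| = k & indep Z I.
Proof.
move=> [irrC ltC].
have CZ i : (i <= k)%N -> C i `<=` Z by move=> /irrC [_ [T _ ->]] x [].
suff [I cI hI] : exists2 I : {set 'I_n}, #|I| = k & indep (C k) I.
  by exists I => //; apply: indepS hI; exact: CZ.
suff h i : (i <= k)%N -> exists2 I : {set 'I_n}, #|I| = i & indep (C i) I by exact: h.
elim: i => [_|i IH ik].
  exists finset.set0 => [|p pI p0]; first by rewrite cards0.
  have pC : p = (p@_(0%MM))%:MP.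
    apply/mpolyP => m; rewrite mcoeffC; case: eqP => [<-|/eqP m0]; first by rewrite mulr1.
    rewrite mulr0; apply/eqP; rewrite mcoeff_eq0; apply: contra m0 => mp.
    by apply/eqP/mnmP => j; rewrite mnmE (pI m mp) // inE.
  have [[_ [z Cz] _] _] := irrC 0%N isT.
  by have := p0 _ Cz; rewrite pC mevalC => ->.
have [I cI hI] := IH (ltnW ik).
have [CC nCC] := ltC i ik.
have [irr [T [S TE] CE]] := irrC i (ltnW ik).
have [irr' _] := irrC i.+1 ik.
have [x Cx nCx] : exists2 x, C i.+1 x & ~ C i x.
  by apply: contrapT => h; apply: nCC => x Cx; apply: contrapT => nCx; apply: h; exists x.
(* One of the equations cutting out [C i] fails at the point [x] of [C i.+1]. *)
have [f Sf fx] : exists2 f, S f & f.@[x] <> 0.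
  apply: contrapT => h; apply: nCx; rewrite CE; split; first exact: (CZ i.+1).
  rewrite TE; split; first by case: irr' => h' _ _; exact: h'.
  by move=> f Sf; apply: contrapT => fx; apply: h; exists f.
have [||j jI hj] := @indep_proper_closed (C i) (C i.+1) f I irr' CC _ _ hI.
- by move=> y; rewrite CE TE => -[_ [_]]; exact.
- by move=> /(_ x Cx).
by exists (j |: I) => //; rewrite cardsU1 jI cI.
Qed.

Lemma indep_maximal Z k C : irreducible_chain Z k C ->
  exists I0, [/\ indep Z I0, (k <= #|I0|)%N & forall I : {set 'I_n}, #|I| = #|I0|.+1 ->
    exists p, [/\ p != 0, vars_in I p & vanishes p Z]].
Proof.
move=> /irreducible_chain_indep [I1 cI1 /asboolP hI1].
case: (@arg_maxnP _ I1 (fun I => `[< indep Z I >]) (fun I : {set 'I_n} => #|I|) hI1).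
move=> I0 /asboolP hI0 max0; exists I0; split=> //; first by rewrite -cI1; exact: max0.
move=> I cI; apply: contrapT => h.
have /max0 : `[< indep Z I >].
  apply/asboolP => p pI pZ; apply/eqP/negPn/negP => p0; apply: h.
  by exists p.
by rewrite /= cI ltnn.
Qed.

End Independence.

(** * Monomials at a place *)

(** If the rank were smaller, the cokernel matrix [N] would have [r + 1] independent rows. With [I]
    their set of indices, a nonzero row of [M] supported on [I] is a nontrivial relation between
    them, because [M *m N = 0]. *)
Lemma rank_supported_rows (R : fieldType) (m n r : nat) (M : 'M[R]_(m, n)) :
  (forall I : {set 'I_n}, #|I| = r.+1 -> exists i, row i M != 0 /\
    forall j, j \notin I -> M i j = 0) -> (n <= \rank M + r)%N.
Proof.
move=> hM; rewrite leqNgt; apply/negP => rM.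
pose N := cokermx M.
have rN : (r < \rank N)%N by rewrite mxrank_coker ltn_subRL.
pose f := maxrankfun N; have f_inj : injective f := @maxrankfun_inj _ _ _ N.
pose I : {set 'I_n} := [set f (widen_ord rN i) | i : 'I_r.+1]%SET.
have [|i [Mi0 Mi]] := hM I.
  rewrite card_imset ?card_ord // => i j /f_inj /(congr1 val) /= ij.
  exact: val_inj.
have MiF j : (forall k, j != f k) -> M i j = 0.
  move=> jf; apply: Mi; apply/imsetP => -[k _ jk].
  by have := jf (widen_ord rN k); rewrite jk eqxx.
pose w := \row_k M i (f k).
have wN : w *m rowsub f N = 0.
  transitivity (row i M *m N); last by rewrite -row_mul mulmx_coker row0.
  apply/rowP => l; rewrite !mxE.
  rewrite [RHS](bigID (mem (f @: [set: 'I_(\rank N)])%SET)) /=.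
  rewrite [X in _ + X]big1 ?addr0.
    rewrite big_imset /=; last by move=> k k' _ _; exact: f_inj.
    by apply: eq_big => [k|k _]; rewrite ?inE // !mxE.
  move=> j /imsetP jf; rewrite mxE MiF ?mul0r // => k; apply/eqP => jk.
  by apply: jf; exists k; rewrite ?inE.
have w0 : w = 0.
  have := maxrowsub_free N; rewrite -/f -kermx_eq0 => /eqP kN.
  have : (w <= kermx (rowsub f N))%MS by apply/sub_kermxP.
  by rewrite kN submx0 => /eqP.
case/eqP: Mi0; apply/rowP => j; rewrite !mxE.
have [[k ->]|nk] := pselect (exists k, j = f k).
  by have := congr1 (fun v : 'rV_(\rank N) => v 0 k) w0; rewrite !mxE.
by apply: MiF => k; apply/eqP => jk; apply: nk; exists k.
Qed.

Lemma map_intr_inj (m n : nat) :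
  injective (map_mx intr : 'M[int]_(m, n) -> 'M[rat]_(m, n)).
Proof.
move=> A B /matrixP AB; apply/matrixP => i j.
by have := AB i j; rewrite !mxE => /intr_inj.
Qed.

(** Rows outside [T] are replaced by zero rather than removed, so that the size of the matrix does
    not depend on [T]. *)
Definition select_rows (m n : nat) (E : 'M[int]_(m, n)) (T : {set 'I_m}) :
    'M[rat]_(m, n) :=
  \matrix_(i, j) if i \in T then (E i j)%:~R else 0.

(* General position with respect to every set of rows of E that can consist of
   exponents of units at a place. *)
Definition transverse (m n r : nat) (E : 'M[int]_(m, n)) (a : 'M[int]_(r, n)) :=
  forall T : {set 'I_m}, (n <= \rank (select_rows E T) + r)%N ->
    row_full (col_mx (map_mx intr a) (select_rows E T)).

Section PlaceExponents.
Variables (K : closedFieldType) (F : fieldType) (iota : {rmorphism K -> F}).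
Variables (n : nat) (X : 'I_n -> F).
Hypothesis X_neq0 : forall j, X j != 0.

Definition mono (e : 'rV[int]_n) : F := \prod_j X j ^ e 0 j.

Lemma mono_neq0 e : mono e != 0.
Proof. by apply/prodf_neq0 => j _; rewrite expfz_neq0. Qed.

Lemma mono0 : mono 0 = 1.
Proof. by rewrite /mono big1 // => j _; rewrite mxE expr0z. Qed.

Lemma monoD e e' : mono (e + e') = mono e * mono e'.
Proof. by rewrite /mono -big_split; apply: eq_bigr => j _; rewrite mxE expfzDr. Qed.

Lemma monoN e : mono (- e) = (mono e)^-1.
Proof. by rewrite /mono -prodfV; apply: eq_bigr => j _; rewrite mxE invr_expz. Qed.

Lemma monoB e e' : mono (e - e') = mono e / mono e'.
Proof. by rewrite monoD monoN. Qed.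

Lemma monoMn e k : mono (e *+ k) = mono e ^+ k.
Proof.
by elim: k => [|k IH]; rewrite ?mulr0n ?mono0 ?expr0 // mulrS exprS monoD IH.
Qed.

Lemma monoMz e z : mono (e *~ z) = mono e ^ z.
Proof. by case: z => k; rewrite ?NegzE ?mulrNz ?monoN ?pmulrn monoMn. Qed.

Lemma mono_delta j : mono (delta_mx 0 j) = X j.
Proof.
rewrite /mono (bigD1 j) //= big1 ?mulr1; first by rewrite mxE !eqxx expr1z.
by move=> k kj; rewrite mxE (negbTE kj) andbF expr0z.
Qed.

Lemma mono_sum (r : nat) (b : 'I_r -> int) (e : 'I_r -> 'rV[int]_n) :
  mono (\sum_i e i *~ b i) = \prod_i mono (e i) ^ b i.
Proof.
rewrite (big_morph mono monoD mono0).
by apply: eq_bigr => i _; rewrite monoMz.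
Qed.

Variables (G : set (F * K)) (hG : place iota G).

Lemma place_unit_expz x z : place_unit G x -> place_unit G (x ^ z).
Proof.
move=> ux; have h k : place_unit G (x ^+ k).
  elim: k => [|k IH]; first exact: place_unit1 hG.
  by rewrite exprS; apply: (place_unitM hG).
by case: z => k; [exact: h|apply: (place_unitV hG)].
Qed.

Lemma place_unit_expz_inj x z : z != 0 -> place_unit G (x ^ z) -> place_unit G x.
Proof.
case: z => k z0 ux; first by apply: (place_unit_pow hG) ux; rewrite lt0n.
apply: (place_unit_pow hG (ltn0Sn k)).
by rewrite -[x ^+ _]invrK; apply: (place_unitV hG).
Qed.

(* The rational span of the exponents of the monomials that are units at G. *)
Definition unit_exponent (v : 'rV[rat]_n) :=
  exists z e, [/\ z != 0, v *~ z = map_mx intr e & place_unit G (mono e)].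


(** Passing to the rational span adds no integral exponents, because a monomial with a nonzero power
    that is a unit is itself a unit. *)
Lemma unit_exponent_int e : unit_exponent (map_mx intr e) <-> place_unit G (mono e).
Proof.
split=> [[z [e' [z0 ez ue']]]|ue]; last by exists 1, e; rewrite mulr1z.
apply: (@place_unit_expz_inj _ z) => //; rewrite -monoMz.
suff -> : e *~ z = e' by [].
by apply: map_intr_inj; rewrite raddfMz.
Qed.

Lemma unit_exponent0 : unit_exponent 0.
Proof.
exists 1, 0; rewrite mulr1z map_mx0 mono0; split=> //.
exact: place_unit1 hG.
Qed.

Lemma unit_exponentD v w :
  unit_exponent v -> unit_exponent w -> unit_exponent (v + w).
Proof.
move=> [z [e [z0 ve ue]]] [t [e' [t0 we ue']]].
exists (z * t), (e *~ t + e' *~ z); split; first exact: mulf_neq0.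
  by rewrite mulrzDl {2}[z * t]mulrC !mulrzA ve we raddfD !raddfMz.
by rewrite monoD !monoMz; apply: (place_unitM hG); exact: place_unit_expz.
Qed.

Lemma unit_exponentZ q v : unit_exponent v -> unit_exponent (q *: v).
Proof.
move=> [z [e [z0 ve ue]]]; exists (z * denq q), (e *~ numq q); split.
- by rewrite mulf_neq0 ?denq_neq0.
- rewrite [RHS](_ : _ = map_mx intr e *~ numq q); last exact: raddfMz.
  rewrite -ve mulrzA -!scaler_int !scalerA numqE; congr (_ *: _).
  by rewrite mulrC mulrA.
- by rewrite monoMz; exact: place_unit_expz.
Qed.

Lemma unit_exponent_sub (m : nat) (M : 'M[rat]_(m, n)) v :
  (forall i, unit_exponent (row i M)) -> (v <= M)%MS -> unit_exponent v.
Proof.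
move=> hM /submxP [u ->]; rewrite mulmx_sum_row.
elim/big_ind: _ => [||i _]; [exact: unit_exponent0|exact: unit_exponentD|].
exact: unit_exponentZ.
Qed.

Lemma unit_select_rows (m : nat) (E : 'M[int]_(m, n)) (T : {set 'I_m}) :
  (forall i, i \in T -> place_unit G (mono (row i E))) ->
  forall i, unit_exponent (row i (select_rows E T)).
Proof.
move=> hT i; have [iT|iT] := boolP (i \in T).
  have -> : row i (select_rows E T) = map_mx intr (row i E).
    by apply/rowP => j; rewrite !mxE iT.
  exact/unit_exponent_int/hT.
have -> : row i (select_rows E T) = 0; last exact: unit_exponent0.
by apply/rowP => j; rewrite !mxE (negbTE iT).
Qed.

(** By transversality the exponents known to give units span the whole rational space, which
    contains the exponent of each coordinate. *)
Lemma transverse_unit (m r : nat) (E : 'M[int]_(m, n)) (a : 'M[int]_(r, n))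
    (T : {set 'I_m}) :
  transverse E a -> (forall i, i \in T -> place_unit G (mono (row i E))) ->
  (n <= \rank (select_rows E T) + r)%N ->
  (forall i, place_unit G (mono (row i a))) -> forall j, place_unit G (X j).
Proof.
move=> ta hT rT ha j; rewrite -mono_delta; apply/unit_exponent_int.
apply: (@unit_exponent_sub _ (col_mx (map_mx intr a) (select_rows E T))).
  move=> i; case: (split_ordP i) => k ->.
    by rewrite rowKu -map_row; exact/unit_exponent_int.
  by rewrite rowKd; exact: unit_select_rows.
by apply: submx_full; exact: ta.
Qed.

(* If no monomial in the variables I0 is a unit, the rational rank of the value
   group is at least #|I0|, so it is generated by the values of the monomials
   with exponents in a transverse matrix, which are therefore independent. *)
Lemma transverse_independent (m : nat) (I0 : {set 'I_n}) (E : 'M[int]_(m, n))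
    (a : 'M[int]_(#|I0|, n)) (T : {set 'I_m}) (b : 'rV[int]_#|I0|) :
  transverse E a -> (forall i, i \in T -> place_unit G (mono (row i E))) ->
  (n <= \rank (select_rows E T) + #|I0|)%N ->
  (forall e : 'rV_n, (forall j, j \notin I0 -> e 0 j = 0) -> place_unit G (mono e) -> e = 0) ->
  place_unit G (mono (b *m a)) -> b = 0.
Proof.
move=> ta hT rT deg ub.
set A := map_mx intr a : 'M[rat]_(_, n).
set V := select_rows E T; rewrite -/V in rT.
set c := map_mx intr (b *m a) : 'rV[rat]_n.
(* The rows of [P] span the coordinate subspace of [I0]. *)
pose P : 'M[rat]_(#|I0|, n) := \matrix_(k < #|I0|) delta_mx 0 (enum_val k).
have rP : \rank P = #|I0|.
  apply/eqP; rewrite -[_ == _]/(row_free P) -kermx_eq0; apply/eqP/row_matrixP => i.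
  rewrite row0; apply/rowP => k.
  have /sub_kermxP : (row i (kermx P) <= kermx P)%MS := row_sub _ _.
  move/rowP => /(_ (enum_val k)); rewrite !mxE (bigD1 k) //= big1 ?addr0.
    by rewrite !mxE !eqxx mulr1.
  by move=> l lk; rewrite !mxE eqxx (inj_eq enum_val_inj) eq_sym (negbTE lk) mulr0.
(* The span of [c] and [V] consists of unit exponents, so it meets the coordinate subspace of [I0]
   only in 0. *)
have cV : (\rank (col_mx c V) + #|I0| <= n)%N.
  rewrite -{1}rP -mxrank_sum_cap.
  suff -> : \rank (col_mx c V :&: P)%MS = 0%N by rewrite addn0 rank_leq_col.
  apply/eqP; rewrite mxrank_eq0; apply/eqP/row_matrixP => i; rewrite row0.
  move: (row_sub i (col_mx c V :&: P)%MS); move: (row i _) => w.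
  rewrite sub_capmx => /andP[wc wP].
  have [z [e [z0 we ue]]] : unit_exponent w.
    apply: unit_exponent_sub wc => k; case: (split_ordP k) => l ->.
      by rewrite rowKu -map_row row_id; exact/unit_exponent_int.
    by rewrite rowKd; exact: unit_select_rows.
  have e0 : e = 0.
    apply: deg ue => j jI; apply: (@intr_inj rat).
    have := congr1 (fun v : 'rV[rat]_n => v 0 j) we; rewrite /= -scaler_int !mxE => <-.
    have /submxP [u ->] := wP; rewrite mxE big1 ?mulr0 // => k _.
    rewrite !mxE eqxx /=; case: eqP => [jk|_]; last by rewrite mulr0.
    by rewrite jk enum_valP in jI.
  move: we; rewrite e0 map_mx0 -scaler_int => /eqP.
  by rewrite scaler_eq0 intr_eq0 (negbTE z0) => /eqP.
have VcV : (V <= col_mx c V)%MS by rewrite -addsmxE addsmxSr.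
(* Together with the lower bound on the rank of [V], this forces [c] to lie in [V]. *)
have rV : \rank V = \rank (col_mx c V).
  apply/eqP; rewrite eqn_leq mxrankS //=.
  by rewrite -(leq_add2r #|I0|) (leq_trans cV).
have ccV : (c <= V)%MS.
  have : (col_mx c V <= V)%MS by rewrite -(geq_leqif (mxrank_leqif_sup VcV)) rV.
  by rewrite col_mx_sub => /andP[].
(* The sum of [A] and [V] is the whole space and the ranks add up to [n], so [A] is free and meets
   [V] only in 0; but [c] lies in both. *)
have full : \rank (A + V)%MS = n by apply/eqP; rewrite addsmxE; exact: ta.
have cap0 : (\rank (A :&: V)%MS + n = \rank A + \rank V)%N.
  by have := mxrank_sum_cap A V; rewrite full addnC.
have rA := rank_leq_row A.
have rVn : (\rank V + #|I0| <= n)%N by rewrite rV.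
have rAI : \rank A = #|I0|.
  by apply/eqP; rewrite eqn_leq rA /=; rewrite -(leq_add2r (\rank V)) -cap0 (leq_trans _ (leq_addl _ _)) // addnC.
have cAV : (c <= A :&: V)%MS.
  by rewrite sub_capmx ccV andbT /c map_mxM submxMl.
have c0 : c = 0.
  apply/eqP; rewrite -submx0; apply: submx_trans cAV _.
  rewrite submx0 -mxrank_eq0 -leqn0 -(leq_add2r n) cap0 add0n.
  by rewrite rAI addnC.
have /row_freeP [B AB] : row_free A by rewrite /row_free rAI.
apply: map_intr_inj; rewrite map_mx0.
by rewrite -[LHS]mulmx1 -AB mulmxA -map_mxM -/c c0 mul0mx.
Qed.

End PlaceExponents.

(** * Places of the function field and points of the variety *)

Section Points.
Variables (K : closedFieldType) (n : nat).

Definition expo (m : 'X_{1..n}) : 'rV[int]_n := \row_j (m j)%:Z.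

(** [E] depends on the variety only and not on a place, so the subsets of its rows are finitely
    many, uniformly in all places. *)
Definition relation_matrix (Z : set ('I_n -> K)) (r m : nat) (E : 'M[int]_(m, n)) :=
  forall I : {set 'I_n}, #|I| = r -> exists p : {mpoly K[n]},
    [/\ p != 0, vars_in I p, vanishes p Z & forall m1 m2, m1 \in msupp p ->
      m2 \in msupp p -> exists i, row i E = expo m1 - expo m2].

Lemma relation_matrix_exists Z r :
  (forall I : {set 'I_n}, #|I| = r -> exists p : {mpoly K[n]},
    [/\ p != 0, vars_in I p & vanishes p Z]) ->
  exists m (E : 'M[int]_(m, n)), relation_matrix Z r E.
Proof.
move=> h.
have /choice [p hp] : forall I : {set 'I_n}, exists p : {mpoly K[n]},
    #|I| = r -> [/\ p != 0, vars_in I p & vanishes p Z].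
  move=> I; have [/eqP/h [p hp]|/eqP nI] := boolP (#|I| == r); first by exists p.
  by exists 0.
pose L := flatten [seq [seq expo m1 - expo m2 | m1 <- msupp (p J), m2 <- msupp (p J)]
  | J <- enum {set 'I_n}].
exists (size L), (\matrix_(i < size L) L`_i) => I /hp [p0 pI pZ].
exists (p I); split=> // m1 m2 h1 h2.
have hL : expo m1 - expo m2 \in L.
  apply/flattenP; exists [seq expo m1 - expo m2 | m1 <- msupp (p I), m2 <- msupp (p I)].
    by apply/mapP; exists I; rewrite ?mem_enum.
  by apply/allpairsP; exists (m1, m2).
have iL : (index (expo m1 - expo m2)%R L < size L)%N by rewrite index_mem.
by exists (Ordinal iL); rewrite rowK nth_index.
Qed.

Variables (Z : set ('I_n -> K)) (F : fieldType) (phi : {rmorphism {mpoly K[n]} -> F}).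
Hypotheses (irrZ : zariski_irreducible Z) (hphi : forall p, phi p = 0 <-> vanishes p Z).

Let iota : {rmorphism K -> F} := phi \o @mpolyC n K.
Let X j := phi 'X_j.

Let X_neq0 j : X j != 0.
Proof.
have [Zt [z Zz] _] := irrZ; apply/eqP => /hphi /(_ z Zz).
by rewrite mevalXU => /eqP; apply/negP; exact: Zt.
Qed.

Lemma phi_mono m : phi 'X_[m] = mono X (expo m).
Proof.
rewrite mpolyXE_id rmorph_prod; apply: eq_bigr => j _.
by rewrite rmorphXn mxE.
Qed.

Lemma phiE p : phi p = \sum_(m <- msupp p) iota p@_m * mono X (expo m).
Proof.
rewrite {1}[p]mpolyE rmorph_sum; apply: eq_bigr => m _.
by rewrite -mul_mpolyC rmorphM phi_mono.
Qed.

Section RankAtPlace.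
Variables (r m : nat) (E : 'M[int]_(m, n)) (relE : relation_matrix Z r.+1 E).
Variables (G : set (F * K)) (hG : place iota G).

Definition unit_rows : {set 'I_m} := [set i | `[< place_unit G (mono X (row i E)) >]]%SET.

Lemma unit_rowsP i : i \in unit_rows -> place_unit G (mono X (row i E)).
Proof. by rewrite inE => /asboolP. Qed.

(** In the relation for each [I], two distinct terms of maximal absolute value give a nonzero row
    supported on [I] whose monomial is a unit; [rank_supported_rows] then applies. *)
Lemma unit_rows_rank : (n <= \rank (select_rows E unit_rows) + r)%N.
Proof.
apply: rank_supported_rows => I /relE [p [p0 pI pZ hE]].
have [|||||m1 [m2 [h1 h2 m12 u12]]] := @place_two_terms _ _ _ _ hG _ (msupp p)
    (fun m => p@_m) (fun m => mono X (expo m)).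
- by rewrite msupp_eq0.
- exact: msupp_uniq.
- by move=> k; rewrite mcoeff_msupp.
- by move=> k _; exact: mono_neq0.
- by rewrite -phiE; exact/hphi.
have [i iE] := hE _ _ h1 h2; exists i.
have iT : i \in unit_rows by rewrite inE; apply/asboolP; rewrite iE monoB.
have sE j : select_rows E unit_rows i j = ((m1 j)%:Z - (m2 j)%:Z)%:~R.
  rewrite mxE iT; congr (_%:~R).
  by have := congr1 (fun v : 'rV_n => v 0 j) iE; rewrite !mxE.
split=> [|j jI]; last by rewrite sE (pI _ h1) // (pI _ h2).
apply: contra m12 => /eqP/rowP h; apply/eqP/mnmP => j.
have := h j; rewrite mxE sE mxE => /eqP.
by rewrite intr_eq0 subr_eq0 => /eqP[].
Qed.

End RankAtPlace.

(* Leading coefficients for the monomial order define a homomorphism that kills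
   the quotient of a monomial in the variables I0 by a larger one. *)
Lemma degenerate_place (I0 : {set 'I_n}) : indep Z I0 ->
  exists2 G, place iota G & forall e : 'rV_n, (forall j, j \notin I0 -> e 0 j = 0) ->
    place_unit G (mono X e) -> e = 0.
Proof.
move=> ind.
(* The fraction [p / X^m], with [m] at least the leading exponent of [p], is sent to the coefficient
   of [p] at [m]. *)
pose G0 := [set z | exists p m, [/\ vars_in I0 p, vars_in I0 'X_[K, m],
  (mlead p <= m)%O & z = (phi p / phi 'X_[m], p@_m)]].
have XN0 m : phi 'X_[m] != 0 by rewrite phi_mono mono_neq0.
have /place_exists [G G0G hG] : partial_hom iota G0.
  split.
  - move=> c; exists c%:MP, 0%MM; split.
    + by rewrite -[c%:MP]mulr1 mul_mpolyC; exact/vars_inZ/vars_in1.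
    + by rewrite mpolyX0; exact: vars_in1.
    + by rewrite mleadC.
    + by rewrite mpolyX0 rmorph1 divr1 mcoeffC eqxx mulr1.
  - move=> _ _ _ _ [p [m [pI mI pm [-> ->]]]] [q [k [qI kI qk [-> ->]]]].
    exists (p * 'X_[k] + q * 'X_[m]), (m + k)%MM; split.
    + by apply: vars_inD; exact: vars_inM.
    + by rewrite mpolyXD; exact: vars_inM.
    + apply: le_trans (mleadD_le _ _) _; rewrite leUx; apply/andP; split.
        by apply: le_trans (mleadM_le _ _) _; rewrite mleadXm; exact: lem_add.
      by rewrite addmC; apply: le_trans (mleadM_le _ _) _; rewrite mleadXm; exact: lem_add.
    + rewrite mcoeffD (mleadcMW pm) ?mleadXm // addmC (mleadcMW qk) ?mleadXm //.
      rewrite !mcoeffX !eqxx !mulr1 mpolyXD rmorphD !rmorphM; congr (_, _).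
      by rewrite addf_div // (mulrC (phi 'X_[m])).
  - move=> _ _ _ _ [p [m [pI mI pm [-> ->]]]] [q [k [qI kI qk [-> ->]]]].
    exists (p * q), (m + k)%MM; split.
    + exact: vars_inM.
    + by rewrite mpolyXD; exact: vars_inM.
    + by apply: le_trans (mleadM_le _ _) _; exact: lem_add.
    + by rewrite mleadcMW // mpolyXD !rmorphM mulf_div.
  - move=> c [p [m [pI mI pm [/esym/eqP]]]].
    rewrite mulf_eq0 invr_eq0 (negbTE (XN0 m)) orbF => /eqP/hphi p0 ->.
    by rewrite (ind _ pI p0) mcoeff0.
exists G => // e eI ue.
have lt_unit m k : vars_in I0 'X_[K, m] -> vars_in I0 'X_[K, k] -> (m < k)%O ->
    ~ place_unit G (mono X (expo m - expo k)).
  move=> mI kI mk [c c0 Gc].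
  have : G (mono X (expo m - expo k), 0).
    apply: G0G; exists 'X_[m], k; split=> //; first by rewrite mleadXm ltW.
    by rewrite mcoeffX (lt_eqF mk) (monoB X_neq0) !phi_mono.
  move/(ph_sub hG Gc); rewrite subrr subr0 => /(ph_fun hG) c00.
  by rewrite c00 eqxx in c0.
(* [m] and [k] are the positive and negative parts of [e]. If they differ, one is smaller for the
   monomial order, so the monomial of [e] or its inverse has value 0. *)
pose m := [multinom if (0 <= e 0 j)%R then absz (e 0 j)%R else 0%N | j < n].
pose k := [multinom if (0 <= e 0 j)%R then 0%N else absz (e 0 j)%R | j < n].
have eE : e = expo m - expo k.
  apply/rowP => j; rewrite !mxE !mnmE; case: ifP => h; first by rewrite subr0 gez0_abs.
  by rewrite sub0r abszE ltr0_norm ?opprK // ltNge h.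
have mI : vars_in I0 'X_[K, m].
  by apply: vars_inX => j jI; rewrite mnmE eI.
have kI : vars_in I0 'X_[K, k].
  by apply: vars_inX => j jI; rewrite mnmE eI.
have [mk|km|mk] := ltgtP m k; last by rewrite eE mk subrr.
  by case: (lt_unit _ _ mI kI mk); rewrite -eE.
case: (lt_unit _ _ kI mI km); rewrite -opprB -eE monoN.
exact: (place_unitV hG).
Qed.

(** At a degenerate place, a nonzero relation would have two distinct terms whose quotient is a
    unit, which [transverse_independent] excludes. *)
Lemma transverse_algebraically_independent (I0 : {set 'I_n}) (m : nat)
    (E : 'M[int]_(m, n)) (a : 'M[int]_(#|I0|, n)) (p : {mpoly K[#|I0|]}) :
  indep Z I0 -> relation_matrix Z #|I0|.+1 E -> transverse E a ->
  mmap iota (fun i => mono X (row i a)) p = 0 -> p = 0.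
Proof.
move=> ind relE ta pu0; apply/eqP; rewrite -msupp_eq0; apply/negPn/negP => p0.
have [G hG deg] := degenerate_place ind.
pose ex (k : 'X_{1..#|I0|}) : 'rV[int]_#|I0| := \row_i (k i)%:Z.
have mmapE k : mmap1 (fun i => mono X (row i a)) k = mono X (ex k *m a).
  rewrite mulmx_sum_row (eq_bigr (fun i => row i a *~ (k i)%:Z)).
    by rewrite mono_sum.
  by move=> i _; rewrite mxE -scaler_int intz.
have [|||||k1 [k2 [h1 h2 k12 u12]]] := @place_two_terms _ _ _ _ hG _ (msupp p)
    (fun k => p@_k) (fun k => mono X (ex k *m a)).
- by [].
- exact: msupp_uniq.
- by move=> k; rewrite mcoeff_msupp.
- by move=> k _; exact: mono_neq0.
- by rewrite -[RHS]pu0; apply: eq_bigr => k _; rewrite mmapE.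
have := transverse_independent X_neq0 hG ta (@unit_rowsP _ E G)
  (unit_rows_rank relE hG) deg (b := ex k1 - ex k2).
rewrite mulmxBl monoB // => /(_ u12) /rowP h.
case/eqP: k12; apply/mnmP => i; have := h i.
by rewrite !mxE => /eqP; rewrite subr_eq0 => /eqP[].
Qed.

Theorem transverse_solvable (I0 : {set 'I_n}) (m : nat)
    (E : 'M[int]_(m, n)) (a : 'M[int]_(#|I0|, n)) (y : 'I_#|I0| -> K) :
  zariski_closed Z -> indep Z I0 -> relation_matrix Z #|I0|.+1 E ->
  transverse E a -> torus y ->
  exists2 x, Z x & forall i, \prod_(j < n) x j ^ a i j = y i.
Proof.
move=> [S ZE] ind relE ta ty.
pose u i := mono X (row i a).
(* The specialization of the monomials with exponents in [a] to [y]; algebraic independence makes it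
   well defined. *)
pose G0 := [set z | exists P : {mpoly K[#|I0|]}, z = (mmap iota u P, P.@[y])].
have /place_exists [G G0G hG] : partial_hom iota G0.
  split.
  - by move=> c; exists c%:MP; rewrite mmapC mevalC.
  - move=> _ _ _ _ [P [-> ->]] [Q [-> ->]]; exists (P + Q).
    by rewrite mmapD mevalD.
  - move=> _ _ _ _ [P [-> ->]] [Q [-> ->]]; exists (P * Q).
    by rewrite rmorphM mevalM.
  - move=> c [P [/esym /(transverse_algebraically_independent ind relE ta) -> ->]].
    by rewrite meval0.
have Gu i : G (u i, y i).
  by apply: G0G; exists 'X_i; rewrite mmapX mmap1U mevalXU.
have uX j : place_unit G (X j).
  apply: (transverse_unit X_neq0 hG ta (@unit_rowsP _ E G)).
    exact: unit_rows_rank relE _ hG.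
  by move=> i; exists (y i); [exact: ty|exact: Gu].
have /choice [x hx] : forall j, exists c, c != 0 /\ G (X j, c).
  by move=> j; have [c c0 Gc] := uX j; exists c.
have Gz c d z : d != 0 -> G (c, d) -> G (c ^ z, d ^ z).
  move=> d0 Gcd; have h k : G (c ^+ k, d ^+ k).
    elim: k => [|k IH]; first by rewrite !expr0; exact: ph1 hG.
    by rewrite !exprS; exact: (ph_mul hG).
  case: z => k; first exact: h.
  by apply: (place_inv hG); rewrite ?expf_neq0.
have Gm e : G (mono X e, \prod_j x j ^ e 0 j).
  rewrite /mono; elim/big_rec2: _ => [|j c d _ IH]; first exact: ph1 hG.
  by apply: (ph_mul hG) => //; apply: Gz; case: (hx j).
(* The place evaluates every polynomial at [x], the point formed by the values of the coordinates.
   Hence the equations of [Z], zero in [F], hold at [x]. *)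
have Gp p : G (phi p, p.@[x]).
  rewrite phiE mevalE; apply: (ph_sum _ hG) => k _.
  apply: (ph_mul hG); first exact: (ph_const hG).
  have := Gm (expo k); congr (G (_, _)).
  by apply: eq_bigr => j _; rewrite mxE.
exists x.
  rewrite ZE; split=> [j|p Sp]; first by case: (hx j).
  apply: (ph_fun hG); have <- : phi p = 0; last exact: Gp.
  by apply/hphi => z; rewrite ZE => -[_]; exact.
move=> i; apply/eqP; rewrite -subr_eq0; apply/eqP/(ph_fun hG).
have := ph_sub hG (Gm (row i a)) (Gu i); rewrite subrr.
by under eq_bigr do rewrite mxE.
Qed.

End Points.

(** * Counting matrices *)

Section Counting.

Lemma leq_card_bigcup (I T : finType) (A : I -> {set T}) :
  (#|(\bigcup_i A i)%SET| <= \sum_i #|A i|)%N.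
Proof.
elim/big_rec2: _ => [|i B m _ IH]; first by rewrite cards0.
by apply: leq_trans (leq_card_setU _ _).1 _; rewrite leq_add2l.
Qed.

(* The pairs (b, t) inject into matrices: overwrite the entry (k, jf b) by t. *)
Lemma card_determined_entry (T : finType) (r n : nat) (P : {set 'M[T]_(r, n)})
    (k : 'I_r) (jf : 'M[T]_(r, n) -> 'I_n) :
  (forall b b' : 'M[T]_(r, n), (forall i j, i != k -> b i j = b' i j) -> jf b = jf b') ->
  (forall b b', b \in P -> b' \in P ->
    (forall i j, (i, j) != (k, jf b) -> b i j = b' i j) -> b = b') ->
  (#|P| * #|T| <= #|T| ^ (r * n))%N.
Proof.
move=> hjf hP; rewrite -card_mx -[#|T|]cardsT -cardsX.
pose g (bt : 'M[T]_(r, n) * T) : 'M[T]_(r, n) :=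
  \matrix_(i, j) if (i, j) == (k, jf bt.1) then bt.2 else bt.1 i j.
rewrite -(@card_in_imset _ _ g); first exact: max_card.
move=> [b t] [b' t']; rewrite !inE /= => /andP[Pb _] /andP[Pb' _] gE.
have jE : jf b = jf b'.
  apply: hjf => i j ik; have := congr1 (fun M : 'M[T]_(r, n) => M i j) gE.
  by rewrite !mxE /= !xpair_eqE (negbTE ik).
have bE : b = b'.
  apply: hP => // i j ij; have := congr1 (fun M : 'M[T]_(r, n) => M i j) gE.
  by rewrite !mxE /= -jE (negbTE ij).
have := congr1 (fun M : 'M[T]_(r, n) => M k (jf b)) gE.
by rewrite !mxE /= -jE eqxx bE => ->.
Qed.

Definition box_val (N : nat) (k : 'I_(2 * N + 1)) : int := k%:Z - N%:Z.

Definition box_mx (r n N : nat) (b : 'M['I_(2 * N + 1)]_(r, n)) : 'M[int]_(r, n) :=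
  map_mx (@box_val N) b.

Lemma box_val_inj N : injective (@box_val N).
Proof. by move=> k l /addIr [] /val_inj. Qed.

Lemma box_mx_inj r n N : injective (@box_mx r n N).
Proof.
move=> b b' /matrixP h; apply/matrixP => i j.
by have := h i j; rewrite !mxE => /box_val_inj.
Qed.

Lemma box_mx_bound r n N (b : 'M['I_(2 * N + 1)]_(r, n)) i j :
  (`|box_mx b i j| <= N)%N.
Proof.
rewrite mxE /box_val; have := ltn_ord (b i j); move: (nat_of_ord _) => k; lia.
Qed.

Lemma box_mx_surj r n N (a : 'M[int]_(r, n)) :
  (forall i j, (`|a i j| <= N)%N) -> exists b, @box_mx r n N b = a.
Proof.
move=> ha.
have ex ij : exists k : 'I_(2 * N + 1), box_val k = a ij.1 ij.2.
  have h : (`|(a ij.1 ij.2 + N%:Z)%R| < 2 * N + 1)%N.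
    by have := ha ij.1 ij.2; move: (a _ _) => z; lia.
  exists (Ordinal h); rewrite /box_val /=; have := ha ij.1 ij.2; move: (a _ _) => z; lia.
have [b hb] := choice ex; exists (\matrix_(i, j) b (i, j)).
by apply/matrixP => i j; rewrite !mxE hb.
Qed.

(** For dimension reasons some nontrivial combination of the rows of [A] lies in [V]. A row [k]
    occurring in it lies in the span [U] of the others and [V], and [U] does not involve row [k],
    which suits counting. *)
Lemma not_full_dependent (R : fieldType) (r m n : nat) (A : 'M[R]_(r, n))
    (V : 'M[R]_(m, n)) :
  (n <= \rank V + r)%N -> ~~ row_full (col_mx A V) ->
  exists k, let U := col_mx (\matrix_(i, j) if i == k then 0 else A i j) V in
    ~~ row_full U /\ (row k A <= U)%MS.
Proof.
move=> rV nf.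
have [u [uAV u0]] : exists u : 'rV_r, (u *m A <= V)%MS /\ u != 0.
  apply: contrapT => nu.
  have u0 (u : 'rV_r) : (u *m A <= V)%MS -> u = 0.
    by move=> uV; apply/eqP/negPn/negP => un0; apply: nu; exists u.
  case/negP: nf; rewrite /row_full -addsmxE eqn_leq rank_leq_col /=.
  apply: leq_trans rV _; rewrite -[leqRHS]addn0.
  have -> : 0%N = \rank (A :&: V)%MS.
    apply/esym/eqP; rewrite mxrank_eq0; apply/eqP/row_matrixP => i; rewrite row0.
    move: (row_sub i (A :&: V)%MS); move: (row i _) => w.
    rewrite sub_capmx => /andP[/submxP [u ->]] /u0 ->.
    by rewrite mul0mx.
  rewrite mxrank_sum_cap addnC leq_add2r.
  suff : row_free A by rewrite /row_free => /eqP ->.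
  rewrite -kermx_eq0; apply/eqP/row_matrixP => i; rewrite row0; apply: u0.
  by have /sub_kermxP -> : (row i (kermx A) <= kermx A)%MS := row_sub _ _; exact: sub0mx.
have [k uk] : exists k, u 0 k != 0.
  apply: contrapT => nk; case/eqP: u0; apply/rowP => k; rewrite mxE.
  by apply/eqP/negPn/negP => uk; apply: nk; exists k.
exists k; set A' := \matrix_(i, j) _; set U := col_mx A' V => /=.
have rowA' i : i != k -> row i A' = row i A.
  by move=> ik; apply/rowP => j; rewrite !mxE (negbTE ik).
have A'U : (A' <= U)%MS by rewrite /U -addsmxE addsmxSl.
have VU : (V <= U)%MS by rewrite /U -addsmxE addsmxSr.
have kU : (row k A <= U)%MS.
  rewrite -[row k A]scale1r -(mulVf uk) -scalerA; apply: scalemx_sub.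
  have -> : u 0 k *: row k A = u *m A - \sum_(i | i != k) u 0 i *: row i A.
    by rewrite mulmx_sum_row (bigD1 k) //= addrK.
  apply: addmx_sub; first exact: submx_trans uAV VU.
  rewrite eqmx_opp; apply: summx_sub => i ik; apply: scalemx_sub.
  by rewrite -(rowA' i ik); exact: submx_trans (row_sub _ _) A'U.
split=> //; apply: contra nf; rewrite -!sub1mx => h; apply: submx_trans h _.
rewrite /U -!addsmxE addsmxS //.
apply/row_subP => i; have [->|ik] := eqVneq i k; last by rewrite rowA' // row_sub.
suff -> : row k A' = 0 by exact: sub0mx.
by apply/rowP => j; rewrite !mxE eqxx.
Qed.

(** Fix the row [k] of [not_full_dependent]. The other rows determine a proper subspace containing
    row [k], hence a nontrivial linear equation for that row, and one of its entries is determined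
    by the rest. Summing over [k] gives the factor [r]. *)
Lemma card_not_full r n m N (V : 'M[rat]_(m, n)) : (n <= \rank V + r)%N ->
  (#|[set b : 'M['I_(2 * N + 1)]_(r, n) |
      ~~ row_full (col_mx (map_mx intr (box_mx b)) V)]%SET| * (2 * N + 1)
    <= r * (2 * N + 1) ^ (r * n))%N.
Proof.
move=> rV; set s := (2 * N + 1)%N.
case: n V rV => [|n] V rV.
  rewrite (_ : [set _ | _]%SET = finset.set0) ?cards0 // -setP => b.
  by rewrite !inE /row_full; apply/negbTE; rewrite negbK eqn_leq rank_leq_col.
pose A (b : 'M['I_s]_(r, n.+1)) : 'M[rat]_(r, n.+1) := map_mx intr (box_mx b).
pose U k b := col_mx (\matrix_(i, j) if i == k then 0 else A b i j) V.
pose P k := [set b | ~~ row_full (U k b) && (row k (A b) <= U k b)%MS]%SET.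
have sub : [set b | ~~ row_full (col_mx (A b) V)]%SET \subset (\bigcup_(k < r) P k)%SET.
  apply/fintype.subsetP => b; rewrite inE => /(not_full_dependent rV) [k [h1 h2]].
  by apply/bigcupP; exists k => //; rewrite inE h1.
have cP k : (#|P k| * s <= s ^ (r * n.+1))%N.
  pose C b := cokermx (U k b).
  (* The position of a nonzero entry of the cokernel matrix; the default value is never reached on
     [P k], where [U k b] is not full. *)
  pose jl b := odflt (ord0, ord0) [pick jl : 'I_n.+1 * 'I_n.+1 | C b jl.1 jl.2 != 0].
  have UE (b b' : 'M['I_s]_(r, n.+1)) :
      (forall i j, i != k -> b i j = b' i j) -> U k b = U k b'.
    move=> bb'; congr (col_mx _ _); apply/matrixP => i j; rewrite !mxE.
    by case: eqP => // /eqP ik; rewrite bb'.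
  have := @card_determined_entry 'I_s r n.+1 (P k) k (fun b => (jl b).1).
  rewrite card_ord; apply=> [b b' /UE bb'|b b']; first by rewrite /jl /C bb'.
  rewrite !inE => /andP[nf kU] /andP[_ kU'] bb'.
  have UU : U k b = U k b' by apply: UE => i j ik; apply: bb'; rewrite xpair_eqE (negbTE ik).
  have jl0 : C b (jl b).1 (jl b).2 != 0.
    rewrite /jl; case: pickP => //= C0; case/negP: nf.
    rewrite -sub1mx submxE mul1mx; apply/eqP/matrixP => i j; rewrite [RHS]mxE.
    exact/eqP/(negbFE (C0 (i, j))).
  have E0 (c : 'M['I_s]_(r, n.+1)) : (row k (A c) <= U k b)%MS ->
      \sum_j A c k j * C b j (jl b).2 = 0.
    rewrite submxE => /eqP/rowP /(_ (jl b).2); rewrite [LHS]mxE [RHS]mxE => h; rewrite -[RHS]h.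
    by apply: eq_bigr => j _; congr (_ * _); rewrite [RHS]mxE.
  have : \sum_j A b' k j * C b j (jl b).2 = \sum_j A b k j * C b j (jl b).2.
    by rewrite !E0 // UU.
  rewrite [LHS](bigD1 (jl b).1) //= [RHS](bigD1 (jl b).1) //=.
  rewrite [X in _ + X = _](_ : _ = \sum_(j | j != (jl b).1) A b k j * C b j (jl b).2); last first.
    by apply: eq_bigr => j jj; rewrite /A !mxE bb' // xpair_eqE (negbTE jj) andbF.
  move=> /addIr/(mulIf jl0); rewrite !mxE => /intr_inj/box_val_inj bk.
  apply/matrixP => i j; have [[-> ->]|ij] := eqVneq (i, j) (k, (jl b).1); first by [].
  exact: bb'.
have le1 : (#|[set b | ~~ row_full (col_mx (A b) V)]%SET| <= \sum_(k < r) #|P k|)%N.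
  apply: leq_trans (subset_leq_card sub) _.
  exact: leq_card_bigcup.
apply: leq_trans (leq_mul le1 (leqnn s)) _.
rewrite big_distrl /= -[X in (_ <= X * _)%N]card_ord -sum_nat_const.
exact: leq_sum.
Qed.

End Counting.

Lemma card_not_transverse (r n m N : nat) (E : 'M[int]_(m, n)) :
  (#|[set b : 'M['I_(2 * N + 1)]_(r, n) | ~~ `[< transverse E (box_mx b) >]]%SET|
     * (2 * N + 1) <= #|{set 'I_m}| * r * (2 * N + 1) ^ (r * n))%N.
Proof.
set s := (2 * N + 1)%N.
pose P (T : {set 'I_m}) := if (n <= \rank (select_rows E T) + r)%N then
  [set b : 'M['I_s]_(r, n) |
    ~~ row_full (col_mx (map_mx intr (box_mx b)) (select_rows E T))]%SET
  else finset.set0.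
have cP T : (#|P T| * s <= r * s ^ (r * n))%N.
  by rewrite /P; case: ifP => [rT|_]; [exact: card_not_full|rewrite cards0].
have sub : [set b : 'M['I_s]_(r, n) | ~~ `[< transverse E (box_mx b) >]]%SET
    \subset (\bigcup_T P T)%SET.
  apply/fintype.subsetP => b; rewrite inE => /asboolPn nt; apply: contrapT => nb.
  apply: nt => T rT; apply: contrapT => /negP nf; apply: nb; apply/bigcupP.
  by exists T => //; rewrite /P rT inE.
apply: (@leq_trans ((\sum_T #|P T|) * s)%N).
  by rewrite leq_mul2r (leq_trans (subset_leq_card sub)) ?leq_card_bigcup ?orbT.
rewrite big_distrl /= -mulnA -sum_nat_const.
exact: leq_sum.
Qed.

(** * Density of the solvable matrices *)

Section Density.
Variables (K : closedFieldType) (n : nat) (W : set ('I_n -> K)).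

Definition solvable (d : nat) (a : 'M[int]_(d, n)) := forall y : 'I_d -> K,
  torus y -> exists2 x, W x & forall i, \prod_(j < n) x j ^ a i j = y i.

Lemma solvable_usubmx (d e : nat) (a : 'M[int]_(d, n)) (b : 'M[int]_(e, n)) :
  solvable (col_mx a b) -> solvable a.
Proof.
(* The additional equations get the right-hand side 1. *)
move=> sab y ty; pose y' (i : 'I_(d + e)) := if fintype.split i is inl k then y k else 1.
have [|x Wx hx] := sab y'.
  by move=> i; rewrite /y'; case: (fintype.split i) => k; [exact: ty|exact: oner_neq0].
exists x => // i; have := hx (lshift e i); rewrite /y' (unsplitK (inl i)) => <-.
by apply: eq_bigr => j _; rewrite col_mxEu.
Qed.

Lemma card_not_solvable (d : nat) (C : nat -> set ('I_n -> K)) :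
  zariski_closed W -> zariski_irreducible W -> irreducible_chain W d C ->
  exists c, forall N,
    (#|[set b : 'M['I_(2 * N + 1)]_(d, n) | ~~ `[< solvable (box_mx b) >]]%SET|
       * (2 * N + 1) <= c * (2 * N + 1) ^ (d * n))%N.
Proof.
move=> Wc Wi /indep_maximal [I0 [ind dI0 max]].
have [F [phi hphi]] := function_field Wi.
have [m [E relE]] := relation_matrix_exists max.
exists (#|{set 'I_m}| * #|I0|)%N => N; set s := (2 * N + 1)%N.
have s0 : (0 < s)%N by rewrite /s addn1.
have := @card_not_transverse #|I0| n m N E; rewrite -/s.
have tS (a : 'M_(#|I0|, n)) : transverse E a -> solvable a.
  by move=> ta y ty; exact: (transverse_solvable Wi hphi Wc ind relE ta ty).
(* From here [#|I0|] is written [d + e]. *)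
move: #|I0| dI0 tS => r /subnKC <-; move: (r - d)%N => e {r} tS.
set B := [set b | _]%SET; set D := [set b | _]%SET => hB.
(* Each of the [s ^ (e * n)] extensions of an unsolvable matrix by [e] rows is unsolvable, hence not
   transverse. *)
have DB : (#|D| * s ^ (e * n) <= #|B|)%N.
  rewrite -[s in (s ^ _)%N]card_ord -card_mx -[#|'M__|]cardsT -cardsX.
  rewrite -(@card_in_imset _ _ (fun bc : 'M['I_s]_(d, n) * 'M['I_s]_(e, n) =>
    col_mx bc.1 bc.2)); last first.
    by move=> [b c] [b' c'] _ _ /eq_col_mx [/= -> ->].
  apply: subset_leq_card; apply/fintype.subsetP => _ /imsetP [[b c] + ->].
  rewrite !inE andbT /= => nb; apply: contra nb => /asboolP tb; apply/asboolP.
  by apply: (@solvable_usubmx d e _ (box_mx c)); rewrite -map_col_mx; exact: tS.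
rewrite -(@leq_pmul2r (s ^ (e * n))) ?expn_gt0 ?s0 // -[leqRHS]mulnA -expnD -mulnDl.
apply: leq_trans hB; rewrite mulnAC leq_mul2r DB orbT //.
Qed.

Lemma solvable_exponents_card (d N : nat) :
  (#|` fset_set (solvable_exponents d W N) | +
    #|[set b : 'M['I_(2 * N + 1)]_(d, n) | ~~ `[< solvable (box_mx b) >]]%SET|
  = (2 * N + 1) ^ (d * n))%N.
Proof.
set s := (2 * N + 1)%N; set B := [set b | _]%SET.
have -> : fset_set (solvable_exponents d W N) = [fset box_mx b | b in (~: B)%SET]%fset.
  apply/fsetP => a; rewrite in_fset_set; last exact: finite_solvable_exponents.
  apply/idP/imfsetP => [|[b /= bB ->]].
    rewrite inE => -[/box_mx_surj [b <-] sb]; exists b => //.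
    by rewrite /= !inE negbK; apply/asboolP.
  rewrite inE; split; first exact: box_mx_bound.
  by move: bB; rewrite !inE negbK => /asboolP.
rewrite card_imfset /=; last exact: box_mx_inj.
by rewrite -cardE addnC cardsC card_mx card_ord.
Qed.

End Density.

Theorem theorem1p4 (R : realType) (K : closedFieldType)
  (charK0 : [pchar K] =i pred0) (n d : nat) (d_gt0 : (0 < d)%N)
  (d_ltn : (d < n)%N) (W : set ('I_n -> K)) (W_nd : geom_nondegenerate W)
  (dimW : has_dim W d) :
  (fun N : nat => (#|` fset_set (solvable_exponents d W N) |)%:R
                  / ((2 * N + 1) ^ (n * d))%N%:R : R) @ \oo --> (1 : R).
Proof.
have [Wc Wi _] := W_nd; have [[C chainC] _] := dimW.
have [c hc] := card_not_solvable Wc Wi chainC.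
(* The proportion of unsolvable matrices is at most [c / (2 * N + 1)], hence at most [c / (N + 1)],
   which is [c] times the harmonic sequence. *)
have lim : (fun N => 1 - c%:R * harmonic N : R) @ \oo --> (1 : R).
  rewrite -[X in _ --> X]subr0 -[X in _ - X](mulr0 c%:R).
  apply: cvgB; first exact: cvg_cst.
  exact: cvgM (cvg_cst _) cvg_harmonic.
apply: (@squeeze_cvgr _ _ _ R _ (fun=> 1) _ _ _ lim (cvg_cst _)); apply: nearW => N.
have := solvable_exponents_card W d N; have := hc N; rewrite (mulnC n d).
set s := (2 * N + 1)%N; set B := #|_|; set S := #|` _|; set t := (s ^ _)%N => h1 h2.
have t0 : 0 < t%:R :> R by rewrite ltr0n expn_gt0 /s addn1.
have Sle : S%:R <= t%:R :> R by rewrite ler_nat -h2 leq_addr.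
rewrite ler_pdivlMr // ler_pdivrMr // mul1r Sle andbT.
have hB : B%:R <= c%:R * t%:R / N.+1%:R :> R.
  rewrite ler_pdivlMr ?ltr0n // -!natrM ler_nat; apply: leq_trans h1.
  by rewrite leq_mul2l /s; lia.
rewrite mulrBl mul1r -[X in X - _]/(t%:R) -{1}h2 natrD.
by rewrite lerBlDr lerD2l (le_trans hB) // /harmonic mulrAC.
Qed.
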